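(* Let $n \geqslant 2$, $s,k\in\mathbb{Z}_+$, $0<\lambda<1$, $m\in\mathbb{Z}_+$, $n+m-1<\delta<n+m$, $T>0$ and $0\leqslant q\leqslant n-1$. Then every element of the image of the operator $d(\varPhi-\varPhi_m)$ acting from $Z^{2s+k,s,\lambda,\frac\lambda2}_{\delta+1,\varLambda^{q+1}}$ to $Z^{2s+k,s,\lambda,\frac\lambda2}_{\delta+1,\varLambda^{q+1}}$ (with $\varPhi=\varPhi_q$, $\varPhi_m=\varPhi_{m,q}$) can be represented in the form $$d\left(\sum_{|I|=q}\sum_{l=1}^{m+1}\sum_{j=1}^{J(l)}\frac{a_{I,l,j}(t)\,h_l^{(j)}(x)\,dx_I}{(n+2l-2)\,\vartheta^{n+2l-2}(x)}\right),$$ where the $a_{I,l,j}$ are functions of the variable $t$ of class $C^{s,\frac\lambda2}([0,T])$ (the usual Hölder class: $s$ times continuously differentiable with $\frac\lambda2$-Hölder continuous derivatives up to order $s$).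
   Context: $\mathbb{Z}_+=\{0,1,2,\dots\}$. Weighted spaces. Put $w(x)=\sqrt{1+|x|^2}$, $w(x,y)=\max\{w(x),w(y)\}$ for $x,y\in\mathbb{R}^n$. $\|u\|_{C^{0,0}_\delta}=\sup_{x\in\mathbb{R}^n}w^\delta(x)|u(x)|$. Fix a non-empty bounded neighbourhood $U$ of $0$ in $\mathbb{R}^n$; for $0<\lambda\leqslant1$ put $\langle u\rangle_{\lambda,\delta,\mathbb{R}^n}=\sup\{ w^{\delta+\lambda}(x,y)\,|u(x)-u(y)|/|x-y|^\lambda : x,y\in\mathbb{R}^n\setminus U,\ x\neq y,\ |x-y|\leqslant |x|/2\}$. On $\mathbb{R}^n\times[0,T]$, for $0<\mu\leqslant1$: $C^{0,0,\lambda,\mu}_{\delta,T}$ is the space of continuous functions with finite norm $\|u\|_{C^{0,0,\lambda,\mu}_{\delta,T}}=\sup_{t\in[0,T]}\|u(\cdot,t)\|_{C^{0,0}_\delta}+\sup_{t\in[0,T]}\langle u(\cdot,t)\rangle_{\lambda,\delta,\mathbb{R}^n}+\sup_{t\neq\tau\in[0,T]}\frac{\|u(\cdot,t)-u(\cdot,\tau)\|_{C^{0,0}_\delta}}{|t-\tau|^\mu}$. $C^{2s,s,\lambda,\mu}_{\delta,T}$ is the space of functions with continuous derivatives $\partial_t^j\partial_x^\alpha u$, $|\alpha|+2j\leqslant2s$, and finite norm $\sum_{|\alpha|+2j\leqslant2s}\|\partial_t^j\partial_x^\alpha u\|_{C^{0,0,\lambda,\mu}_{\delta+|\alpha|,T}}$.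 $C^{2s+k,s,\lambda,\mu}_{\delta,T}$ is the space of functions with finite norm $\sum_{|\beta|\leqslant k}\|\partial_x^\beta u\|_{C^{2s,s,\lambda,\mu}_{\delta+|\beta|,T}}$. $C^{2s+k,s,\lambda,\mu}_{\delta,T,\varLambda^q}$ denotes forms $u=\sum_{|I|=q}u_I(x,t)\,dx_I$ with coefficients in $C^{2s+k,s,\lambda,\mu}_{\delta,T}$; $t$ is a parameter. $d$ is the exterior derivative in the variables $x$ only, $d^*$ its formal adjoint (in $x$). $\Gamma^{2s+k,s,\lambda,\frac\lambda2}_{\delta,T,\varLambda^q}$ (the subscript $T$ is often omitted) is the completion of the space $C^{2s+k,s,\lambda,\frac\lambda2}_{\delta,T,\varLambda^q}$ (of its elements for which the following expression is finite) with respect to the norm $$\|u\|_{C^{2s+k,s,\lambda,\frac\lambda2}_{\delta,T,\varLambda^q}}+\|du\|_{C^{2s+k,s,\lambda,\frac\lambda2}_{\delta+1,T,\varLambda^{q+1}}}+\|d^*u\|_{C^{2s+k,s,\lambda,\frac\lambda2}_{\delta+1,T,\varLambda^{q-1}}}.$$ $Z^{2s+k,s,\lambda,\frac\lambda2}_{\delta,\varLambda^q}$ is the set of $f\in\Gamma^{2s+k,s,\lambda,\frac\lambda2}_{\delta,\varLambda^q}$ with $df=0$. Potentials. Let $(d^q)^*$ be the formal adjoint of the exterior derivative $d^q$ on $q$-forms on $\mathbb{R}^n$, $\sigma_n$ the area of the unit sphere $\partial B_1$ in $\mathbb{R}^n$, $\star$ the Hodge star, and $e$ the standard fundamental solution of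 the Laplace operator: $e(x)=\frac{1}{2\pi}\ln|x|$ for $n=2$, $e(x)=\frac{1}{\sigma_n}\frac{|x|^{2-n}}{2-n}$ for $n\geqslant3$. Put $e_q(x,y)=\sum_{|I|=q}e(x-y)(\star dy_I)\,dx_I$ and $\phi_q(x,y)=(d^{n-q-1})^*_y e_q(x,y)$ (the operator acts in $y$). Let $h_l^{(j)}$, $1\leqslant j\leqslant J(l)$, $l\in\mathbb{Z}_+$, be homogeneous harmonic polynomials of degree $l$ on $\mathbb{R}^n$ ($J(l)$ being the dimension of the space of these) whose restrictions form an orthonormal basis of $L^2(\partial B_1)$. Let $\vartheta$ be a fixed smooth function with $\vartheta(x)=|x|$ for $|x|\geqslant 2$ and $0<1/\vartheta(x)\leqslant1$. For $m\in\mathbb{Z}_+$ put $$\phi_{m,q}(x,y)=\phi_q(x,y)+\sum_{|I|=q}\sum_{l=1}^{m+1}\sum_{j=1}^{J(l)}\frac{h_l^{(j)}(x)\,(d^{n-q-1})^*_y\big(h_l^{(j)}(y)(\star dy_I)\big)dx_I}{(n+2l-2)\,\vartheta^{n+2l-2}(x)}.$$ For a $(q+1)$-form $f$ depending on the parameter $t$, $(\varPhi_q f)(x,t)=\int_{\mathbb{R}^n}f(y,t)\wedge\phi_q(x,y)$ and $(\varPhi_{m,q}f)(x,t)=\int_{\mathbb{R}^n}f(y,t)\wedge\phi_{m,q}(x,y)$ (integration in $y$). *)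

(* Defs.v *)
From HB Require Import structures.
From mathcomp Require Import all_boot all_order all_algebra.
From mathcomp Require Import all_classical all_reals all_analysis.
(* Not imported: its notations clash with those of mathcomp-analysis. *)
From mathcomp Require mpoly.

Set Implicit Arguments.
Unset Strict Implicit.
Unset Printing Implicit Defensive.

Import Order.TTheory GRing.Theory Num.Theory.
Import numFieldNormedType.Exports.

Local Open Scope classical_set_scope.
Local Open Scope ring_scope.

Section LebesgueRn.
Context {R : realType}.
Notation Rm := (measurableTypeR R).

Definition tcons (n : nat) (p : Rm * n.-tuple Rm) : n.+1.-tuple Rm :=
  [tuple of p.1 :: p.2].

Lemma measurable_tcons n : measurable_fun setT (@tcons n).
Proof. exact: measurable_cons. Qed.

Section step.
Variables (n : nat) (mu : {sigma_finite_measure set (n.-tuple Rm) -> \bar R}).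

Definition lebesgue_tcons (A : set (n.+1.-tuple Rm)) : \bar R :=
  pushforward (lebesgue_measure \x mu)%E (@tcons n) A.

Lemma lebesgue_tcons0 : lebesgue_tcons set0 = 0%E.
Proof. by rewrite /lebesgue_tcons /pushforward preimage_set0 measure0. Qed.

Lemma lebesgue_tcons_ge0 A : (0 <= lebesgue_tcons A)%E.
Proof. by rewrite /lebesgue_tcons /pushforward; exact: measure_ge0. Qed.

Lemma lebesgue_tcons_sigma_additive : semi_sigma_additive lebesgue_tcons.
Proof.
move=> F mF tF mUF; rewrite /lebesgue_tcons /pushforward preimage_bigcup.
apply: measure_semi_sigma_additive.
- by move=> k; rewrite -[X in measurable X]setTI; exact: measurable_tcons.
- apply/trivIsetP => /= i j _ _ ij; rewrite -preimage_setI.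
  by move/trivIsetP : tF => /(_ _ _ _ _ ij) ->//; rewrite preimage_set0.
- by rewrite -preimage_bigcup -[X in measurable X]setTI; exact: measurable_tcons.
Qed.

HB.instance Definition _ := isMeasure.Build _ _ _ lebesgue_tcons
  lebesgue_tcons0 lebesgue_tcons_ge0 lebesgue_tcons_sigma_additive.

Lemma lebesgue_tcons_sigma_finite : sigma_finite setT lebesgue_tcons.
Proof.
have /sigma_finiteP[F [TF ndF Foo]] := sigma_finiteT (@lebesgue_measure R).
have /sigma_finiteP[G [TG ndG Goo]] := sigma_finiteT mu.
have mthead : measurable_fun setT (fun t : n.+1.-tuple Rm => thead t).
  exact: measurable_tnth.
have mbehead := @measurable_behead _ Rm n.
exists (fun k => [set t : n.+1.-tuple Rm | F k (thead t) /\
                   G k [tuple of behead t]]).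
  rewrite predeqE => t; split=> // _.
  have [i _ Fi] : (\bigcup_k F k) (thead t) by rewrite -TF.
  have [j _ Gj] : (\bigcup_k G k) [tuple of behead t] by rewrite -TG.
  exists (maxn i j) => //; split.
  - by move: (thead t) Fi; exact/subsetPset/ndF/leq_maxl.
  - by move: [tuple of behead t] Gj; exact/subsetPset/ndG/leq_maxr.
move=> k; have [mF Fk] := Foo k; have [mG Gk] := Goo k; split.
  apply: measurableI; [rewrite -[X in measurable X]setTI; exact: mthead|].
  by rewrite -[X in measurable X]setTI; exact: mbehead.
rewrite /lebesgue_tcons /pushforward.
rewrite [X in product_measure1 _ _ X](_ : _ = F k `*` G k); last first.
  rewrite predeqE => -[a t]; rewrite /= theadE.
  by rewrite (_ : [tuple of _] = t) //; exact/val_inj.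
by rewrite product_measure1E// lte_mul_pinfty// ge0_fin_numE.
Qed.

HB.instance Definition _ := @Measure_isSigmaFinite.Build _ _ _ lebesgue_tcons
  lebesgue_tcons_sigma_finite.

End step.

(* Lebesgue measure on R^n: the n-fold product measure on tuples. *)
Fixpoint lebesgue_tuple (n : nat) :
    {sigma_finite_measure set (n.-tuple Rm) -> \bar R} :=
  match n with
  | 0 => \d_([tuple] : 0.-tuple Rm)
  | k.+1 => lebesgue_tcons (lebesgue_tuple k)
  end.

End LebesgueRn.

Section Euclidean.
Context {R : realType} {n : nat}.
Implicit Types x y : 'rV[R]_n.

(* The library norm on 'rV[R]_n is the sup norm. *)
Definition enorm x : R := Num.sqrt (\sum_i x 0 i ^+ 2).

Definition basis_vec (i : 'I_n) : 'rV[R]_n := delta_mx 0 i.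

Definition row_of_tuple (t : n.-tuple (measurableTypeR R)) : 'rV[R]_n :=
  \row_i tnth t i.

Definition intRn (D : set 'rV[R]_n) (g : 'rV[R]_n -> R) : R :=
  Rintegral (lebesgue_tuple n) (row_of_tuple @^-1` D) (g \o row_of_tuple).

Definition unit_ball : set 'rV[R]_n := [set x | enorm x <= 1].

Definition radial_proj x : 'rV[R]_n := (enorm x)^-1 *: x.

(* Integral over the unit sphere for the surface measure; by polar
   coordinates, the integral of the degree-0 homogeneous extension of g over
   the unit ball is (1/n) times the integral of g over the sphere. *)
Definition sphere_int (g : 'rV[R]_n -> R) : R :=
  n%:R * intRn unit_ball (g \o radial_proj).

Definition sphere_area : R := sphere_int (fun=> 1).

Definition sphere_L2 (g : 'rV[R]_n -> R) : Prop :=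
  measurable_fun setT (g \o radial_proj \o row_of_tuple) /\
  (lebesgue_tuple n).-integrable (row_of_tuple @^-1` unit_ball)
    (fun t => ((g (radial_proj (row_of_tuple t))) ^+ 2)%:E).

Definition pderiv (i : 'I_n) (g : 'rV[R]_n -> R) : 'rV[R]_n -> R :=
  fun x => 'D_(basis_vec i) g x.

Definition mpderiv (al : 'I_n -> nat) (g : 'rV[R]_n -> R) : 'rV[R]_n -> R :=
  foldr (fun i v => iter (al i) (pderiv i) v) g (enum 'I_n).

(* The multi-indices with all components < N, a finite type. *)
Definition midx (N : nat) (al : {ffun 'I_n -> 'I_N}) : 'I_n -> nat :=
  fun i => val (al i).

Definition mdegree (al : 'I_n -> nat) : nat := (\sum_i al i)%N.

Definition smooth (g : 'rV[R]_n -> R) : Prop :=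
  forall al : 'I_n -> nat, continuous (mpderiv al g) /\
    forall i x, derivable (mpderiv al g) x (basis_vec i).

End Euclidean.

Section Harmonics.
Import (canonicals,coercions) mpoly.
Context {R : realType} {n : nat}.
Notation poly := (mpoly.mpoly n R).

Definition harmonic_homog (l : nat) (p : poly) : Prop :=
  p \is mpoly.ishomog1 l (@mpoly.mdeg n) /\
  \sum_i mpoly.mderiv i (mpoly.mderiv i p) = 0.

Definition peval (p : poly) (x : 'rV[R]_n) : R := mpoly.meval (x 0) p.

Definition harmonic_dim (l N : nat) : Prop :=
  exists b : 'I_N -> poly, (forall j, harmonic_homog l (b j)) /\
    forall p, harmonic_homog l p ->
      exists! c : {ffun 'I_N -> R}, p = \sum_j c j *: b j.

(* Orthonormality in L^2 of the unit sphere of the whole family, and density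
   of its span. *)
Definition sphere_orthonormal_basis (J : nat -> nat)
    (h : forall l, 'I_(J l) -> 'rV[R]_n -> R) : Prop :=
  [/\ forall l j, sphere_int (fun x => h l j x ^+ 2) = 1,
      forall l j l' j', (l, val j) != (l', val j') ->
        sphere_int (fun x => h l j x * h l' j' x) = 0
    & forall g, sphere_L2 g -> forall eps, 0 < eps ->
        exists (N : nat) (c : forall l, 'I_(J l) -> R),
          sphere_int (fun x =>
            (g x - \sum_(l < N) \sum_(j < J l) c l j * h l j x) ^+ 2) < eps].

Definition spherical_harmonics (J : nat -> nat)
    (h : forall l, 'I_(J l) -> poly) : Prop :=
  [/\ forall l, harmonic_dim l (J l),
      forall l j, harmonic_homog l (h l j)
    & sphere_orthonormal_basis (fun l j => peval (h l j))].

End Harmonics.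

(* A multivector is the family of its coefficients on all the dx_I, where the
   increasing multi-index I is identified with the set of its indices; the
   q-forms are those supported on the I with #|I| = q. *)
Section Forms.
Context {R : realType} {n : nat}.

Definition multivec := {ffun {set 'I_n} -> R}.

Definition diff_form := 'rV[R]_n -> multivec.

Definition dxI (I : {set 'I_n}) : multivec := [ffun K => (K == I)%:R].

(* The sign with dx_I /\ dx_K = wsign I K dx_(I :|: K), for disjoint I, K. *)
Definition wsign (I K : {set 'I_n}) : R :=
  (-1) ^+ #|[pred p : 'I_n * 'I_n | [&& p.1 \in I, p.2 \in K & (p.2 < p.1)%N]]|.

Definition wedge_mv (a b : multivec) : multivec :=
  [ffun K : {set 'I_n} => \sum_(I : {set 'I_n} | I \subset K)
     wsign I (K :\: I)%SET * a I * b (K :\: I)%SET].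

(* dx_I /\ hodge dx_I is the volume form. *)
Definition hodge (a : multivec) : multivec :=
  [ffun K : {set 'I_n} => wsign (~: K)%SET K * a (~: K)%SET].

Definition extd (u : diff_form) : diff_form := fun x =>
  [ffun K : {set 'I_n} => \sum_(i in K)
     wsign [set i]%SET (K :\ i)%SET * pderiv i (fun z => u z (K :\ i)%SET) x].

(* The formal adjoint of extd: \int <extd u, v> = \int <u, codiff v> for
   compactly supported u, v, the dx_I being orthonormal. *)
Definition codiff (v : diff_form) : diff_form := fun x =>
  [ffun K : {set 'I_n} => - \sum_(i | i \notin K)
     wsign [set i]%SET K * pderiv i (fun z => v z (i |: K)%SET) x].

Definition form_int (w : diff_form) : R := intRn setT (fun y => w y [set: 'I_n]%SET).

End Forms.
Arguments multivec : clear implicits.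
Arguments diff_form : clear implicits.

(* A function on R^n x [0,T] is u : R -> 'rV[R]_n -> R, time first; only its
   values at times in [0,T] matter. *)
Section Spaces.
Context {R : realType} {n : nat}.
Variables (U : set 'rV[R]_n) (T : R).
Implicit Types (g : 'rV[R]_n -> R) (u : R -> 'rV[R]_n -> R).
Implicit Types (x y : 'rV[R]_n).

Definition weight x : R := Num.sqrt (1 + enorm x ^+ 2).

Definition weight2 x y : R := Num.max (weight x) (weight y).

Definition normC0 (dl : R) g : \bar R :=
  ereal_sup [set (weight x `^ dl * `|g x|)%:E | x in [set: 'rV[R]_n]].

Definition hoelder_semi (lam dl : R) g : \bar R :=
  ereal_sup [set e : \bar R | exists x y,
    [/\ ~ U x, ~ U y, x != y, enorm (x - y) <= enorm x / 2 &
        e = (weight2 x y `^ (dl + lam) * `|g x - g y|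
             / enorm (x - y) `^ lam)%:E]].

Definition normC (lam mu dl : R) u : \bar R :=
  (ereal_sup [set normC0 dl (u t) | t in `[0%R, T]%classic]
   + ereal_sup [set hoelder_semi lam dl (u t) | t in `[0%R, T]%classic]
   + ereal_sup [set e : \bar R | exists t tau : R,
       [/\ t \in `[0%R, T], tau \in `[0%R, T], t != tau &
           e = normC0 dl (fun x => (u t x - u tau x)%R)
               * ((`|t - tau| `^ mu)^-1)%R%:E]])%E.

Definition continuous_cyl u : Prop :=
  {within [set p : R * 'rV[R]_n | 0 <= p.1 <= T],
    continuous (fun p : R * 'rV[R]_n => u p.1 p.2)}.

(* Time derivatives on [0,T], one-sided at the end points. *)
Definition tquot (a : R -> R) (t : R) : R -> R :=
  fun tau => (a tau - a t) / (tau - t).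

Definition tderivable (a : R -> R) (t : R) : Prop :=
  cvg (tquot a t @ within `[0, T] t^').

Definition tderiv (a : R -> R) (t : R) : R :=
  lim (tquot a t @ within `[0, T] t^').

Definition dtx (j : nat) (al : 'I_n -> nat) u : R -> 'rV[R]_n -> R :=
  fun t x => iter j tderiv (fun tau => mpderiv al (u tau) x) t.

Definition inC2s (s : nat) (lam mu dl : R) u : Prop :=
  [/\ forall al i t x, (mdegree al < 2 * s)%N -> t \in `[0, T] ->
        derivable (mpderiv al (u t)) x (basis_vec i),
      forall j al t x, (mdegree al + 2 * j.+1 <= 2 * s)%N -> t \in `[0, T] ->
        tderivable (fun tau => dtx j al u tau x) t,
      forall j al, (mdegree al + 2 * j <= 2 * s)%N ->
        continuous_cyl (dtx j al u)
    & forall j al, (mdegree al + 2 * j <= 2 * s)%N ->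
        (normC lam mu (dl + (mdegree al)%:R) (dtx j al u) < +oo)%E].

Definition normC2s (s : nat) (lam mu dl : R) u : \bar R :=
  (\sum_(j < s.+1) \sum_(al : {ffun 'I_n -> 'I_(2 * s).+1}
                         | (mdegree (midx al) + 2 * j <= 2 * s)%N)
     normC lam mu (dl + (mdegree (midx al))%:R)%R (dtx j (midx al) u))%E.

Definition inC2sk (s k : nat) (lam mu dl : R) u : Prop :=
  (forall be i t x, (mdegree be < k)%N -> t \in `[0, T] ->
     derivable (mpderiv be (u t)) x (basis_vec i)) /\
  (forall be, (mdegree be <= k)%N ->
     inC2s s lam mu (dl + (mdegree be)%:R) (fun t => mpderiv be (u t))).

Definition normC2sk (s k : nat) (lam mu dl : R) u : \bar R :=
  (\sum_(be : {ffun 'I_n -> 'I_k.+1} | (mdegree (midx be) <= k)%N)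
     normC2s s lam mu (dl + (mdegree (midx be))%:R)%R
       (fun t => mpderiv (midx be) (u t)))%E.

Implicit Types f : R -> diff_form R n.

Definition inCform (s k : nat) (lam mu dl : R) (q : nat) f : Prop :=
  (forall I : {set 'I_n}, #|I| = q ->
     inC2sk s k lam mu dl (fun t x => f t x I)) /\
  (forall (I : {set 'I_n}) t x, #|I| <> q -> t \in `[0, T] -> f t x I = 0).

Definition normCform (s k : nat) (lam mu dl : R) (q : nat) f : \bar R :=
  (\sum_(I : {set 'I_n} | #|I| == q)
     normC2sk s k lam mu dl (fun t x => f t x I))%E.

(* Makes the classical d and d^* meaningful when 2s + k = 0 (it is automatic
   otherwise). *)
Definition C1x f : Prop :=
  forall (I : {set 'I_n}) i,
    (forall t x, t \in `[0, T] ->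
       derivable (fun z => f t z I) x (basis_vec i)) /\
    continuous_cyl (fun t => pderiv i (fun z => f t z I)).

Definition inGraph (s k : nat) (lam dl : R) (q : nat) f : Prop :=
  [/\ inCform s k lam (lam / 2) dl q f, C1x f,
      inCform s k lam (lam / 2) (dl + 1) q.+1 (fun t => extd (f t))
    & inCform s k lam (lam / 2) (dl + 1) q.-1 (fun t => codiff (f t))].

(* The norm of Gamma at a triple (u, v, w); it is applied to v = du and
   w = d^* u, and to limits of such triples. *)
Definition graph_norm (s k : nat) (lam dl : R) (q : nat)
    (u v w : R -> diff_form R n) : \bar R :=
  (normCform s k lam (lam / 2) dl q u
   + normCform s k lam (lam / 2) (dl + 1) q.+1 v
   + normCform s k lam (lam / 2) (dl + 1) q.-1 w)%E.

(* The spaces C^{2s+k,s,lam,lam/2} are Banach spaces and d, d^* are closable,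
   so that the completion Gamma is the set of the forms f arising as limits of
   sequences u_ such that (u_, d u_, d^* u_) converges to some (f, df, dsf);
   df and dsf are determined by f and are the extensions of d and d^* to
   Gamma.  For q = 0 the components of degree q.-1 vanish. *)
Definition inGamma (s k : nat) (lam dl : R) (q : nat)
    (f df dsf : R -> diff_form R n) : Prop :=
  [/\ inCform s k lam (lam / 2) dl q f,
      inCform s k lam (lam / 2) (dl + 1) q.+1 df,
      inCform s k lam (lam / 2) (dl + 1) q.-1 dsf
    & exists u_ : nat -> R -> diff_form R n,
        (forall r, inGraph s k lam dl q (u_ r)) /\
        (fun r => graph_norm s k lam dl q
           (fun t x => u_ r t x - f t x)
           (fun t x => extd (u_ r t) x - df t x)
           (fun t x => codiff (u_ r t) x - dsf t x)) @ \oo --> (0 : \bar R)].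

Definition inZ (s k : nat) (lam dl : R) (q : nat) f : Prop :=
  exists dsf, inGamma s k lam dl q f (fun _ _ => 0) dsf.

Definition inC_time (s : nat) (mu : R) (a : R -> R) : Prop :=
  [/\ forall j t, (j < s)%N -> t \in `[0, T] -> tderivable (iter j tderiv a) t,
      forall j, (j <= s)%N -> {within `[0, T], continuous (iter j tderiv a)}
    & forall j, (j <= s)%N -> exists C : R, forall t tau,
        t \in `[0, T] -> tau \in `[0, T] ->
        `|iter j tderiv a t - iter j tderiv a tau| <= C * `|t - tau| `^ mu].

End Spaces.

Section Potentials.
Context {R : realType} {n : nat}.

Definition fundsol (x : 'rV[R]_n) : R :=
  if n == 2%N then ln (enorm x) / (2 * pi)
  else (enorm x ^+ (n - 2))^-1 / ((2 - n%:R) * @sphere_area R n).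

(* A double form \sum_I w_I(x, y) dx_I is given by its coefficients w_I(x, .),
   which are forms in y. *)
Definition double_form := 'rV[R]_n -> {set 'I_n} -> diff_form R n.

Definition ker_phi : double_form := fun x I =>
  codiff (fun y => fundsol (x - y) *: hodge (dxI I)).

Variables (J : nat -> nat) (h : forall l, 'I_(J l) -> mpoly.mpoly n R).
Variable theta : 'rV[R]_n -> R.

Definition ext_harmonic (l : nat) (j : 'I_(J l)) (x : 'rV[R]_n) : R :=
  peval (h j) x / ((n + 2 * l - 2)%:R * theta x ^+ (n + 2 * l - 2)).

Definition ker_phi_m (m : nat) : double_form := fun x I y =>
  ker_phi x I y + \sum_(1 <= l < m.+2) \sum_(j < J l)
    ext_harmonic j x *: codiff (fun z => peval (h j) z *: hodge (dxI I)) y.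

(* The q-form \int_y f(y, t) /\ ker(x, y). *)
Definition potential (ker : double_form) (q : nat) (f : R -> diff_form R n) :
    R -> diff_form R n := fun t x =>
  \sum_(I : {set 'I_n} | #|I| == q)
    form_int (fun y => wedge_mv (f t y) (ker x I y)) *: dxI I.

End Potentials.

(* Main.v *)
Require Import Defs.
From mathcomp Require Import all_boot all_order all_algebra.
From mathcomp Require Import all_classical all_reals all_analysis.
From mathcomp Require mpoly.
From mathcomp Require Import measurable_realfun ring lra.

Set Implicit Arguments.
Unset Strict Implicit.
Unset Printing Implicit Defensive.

Import Order.TTheory GRing.Theory Num.Theory.
Import numFieldNormedType.Exports.

Local Open Scope classical_set_scope.
Local Open Scope ring_scope.

(** The two potentials differ by the sum over [I], [l], [j] of [ext_harmonic h theta j]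
    times the constant-in-[x] number [- \int f /\ d^*(h_l^(j) *dx_I)].  This splitting
    of the integral is legitimate because a form of weight [dl + 1] is
    [O(w^-(dl+1))], so that its products with the kernel [phi_q(x, .)], which is
    [O(|x - y|^(1-n))], and with the polynomials of degree [l - 1 <= m] are all
    integrable.  Integrability is reduced to one variable: both majorants are bounded by
    a product of functions [kern s] of the coordinates [x_i - y_i], each of which has a
    bounded explicit primitive.  The moments of [f] inherit its regularity in time, since
    the difference quotients of the integrand are values of its time derivative at
    intermediate times and these are Hoelder continuous with an integrable constant. *)

(** * A singular integral in one variable *)

(** The measure on R^n is an iterated product, so the radial bounds on the integrands have to be
    traded for products over the coordinates. This is possible because a nonincreasing [g] satisfies
    [g(|r|)^n <= prod_i g(|r_i|)], each [|r_i|] being at most [|r|]. Take [g] of size [r^(s-1)] at 0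
    and [r^(-s-1)] at infinity, which is integrable for every [s > 0] and nonincreasing for
    [s <= 1]: its product dominates [|r|^(n(s-1))] at 0 and [|r|^(-n(s+1))] at infinity. A small [s]
    therefore covers the singularity [|r|^(1-n)] together with any decay [|r|^(-p)], [p > n].

    Here [p = dl + 1 - m]: the weight of the form minus the degree of the polynomial kernels, and
    [p > n] is the lower bound imposed on [dl].

    The two forms are shown to agree at every point before [d] is applied, so that [d] never has to
    be exchanged with an integral. *)

(** Monotone convergence along compact intervals, on each of which the integral is an increment of
    [F]. The end points of the union, where [g] may blow up, are never touched. *)
Lemma le_integral_bigcup_derivative (R : realType) (a b : nat -> R) (F g : R -> R)
    (M : R) :
  (forall k, a k < b k) ->
  nondecreasing_seq (fun k => `[a k, b k]%classic) ->
  (forall k y, y \in `[a k, b k] -> is_derive y 1 F (g y)) ->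
  (forall k y, y \in `[a k, b k] -> {for y, continuous g}) ->
  (forall k y, y \in `[a k, b k] -> 0 <= g y) ->
  (forall u v, F u - F v <= M) ->
  (\int[lebesgue_measure]_(y in \bigcup_k `[a k, b k]%classic) (g y)%:E <= M%:E)%E.
Proof.
move=> ab nd dF cg g0 FM.
have cw k : {within `[a k, b k], continuous g}.
  by apply: continuous_in_subspaceT => y /set_mem; exact: cg.
have mg k : measurable_fun `[a k, b k]%classic g.
  exact: subspace_continuous_measurable_fun.
have cvg : (\int[lebesgue_measure]_(y in `[a k, b k]) (g y)%:E)%E @[k --> \oo] -->
    (\int[lebesgue_measure]_(y in \bigcup_k `[a k, b k]%classic) (g y)%:E)%E.
  apply: (@ge0_nondecreasing_set_cvg_integral _ (measurableTypeR R)) => //.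
  by move=> k; apply/measurable_EFinP; exact: mg.
rewrite -(cvg_lim _ cvg) //; apply: lime_le; first by apply/cvg_ex; eexists; exact: cvg.
apply: nearW => k.
rewrite (@continuous_FTC2 _ g F) //.
- by rewrite -EFinB lee_fin.
- have cF y : y \in `[a k, b k] -> {for y, continuous F}.
    move=> yk; apply: differentiable_continuous; apply/derivable1_diffP.
    by have [] := dF _ _ yk.
  split.
  + move=> y yk; have yk' : y \in `[a k, b k] by exact: subset_itv_oo_cc.
    by have [] := dF _ _ yk'.
  + by apply: cvg_at_right_filter; apply: cF; rewrite in_itv /= lexx ltW.
  + by apply: cvg_at_left_filter; apply: cF; rewrite in_itv /= lexx ltW.
- move=> y yk; have yk' : y \in `[a k, b k] by exact: subset_itv_oo_cc.
  by rewrite derive1E; have [] := dF _ _ yk'.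
Qed.

Lemma is_derive1_comp (R : realType) (f g : R -> R) (x df dg : R) :
  is_derive x 1 f df -> is_derive (f x) 1 g dg -> is_derive x 1 (g \o f) (dg * df).
Proof.
move=> [f1 f2] [g1 g2]; split; last first.
  by rewrite -derive1E derive1_comp // !derive1E f2 g2.
by apply/derivable1_diffP/differentiable_comp; exact/derivable1_diffP.
Qed.

(** These intervals exhaust the positive half-line; with [k.+1] the first one would shrink to a
    point. *)
Lemma exists_nat_between (R : realType) (r : R) : 0 < r ->
  exists k : nat, k.+2%:R^-1 <= r <= k.+2%:R.
Proof.
move=> r0; have r1 : 0 < r^-1 by rewrite invr_gt0.
exists (maxn (Num.bound r) (Num.bound r^-1)).
have b1 := archi_boundP (ltW r0); have b2 := archi_boundP (ltW r1).
have le1 : (Num.bound r <= (maxn (Num.bound r) (Num.bound r^-1)).+2)%N.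
  by rewrite -addn2 (leq_trans (leq_maxl _ (Num.bound r^-1))) // leq_addr.
have le2 : (Num.bound r^-1 <= (maxn (Num.bound r) (Num.bound r^-1)).+2)%N.
  by rewrite -addn2 (leq_trans (leq_maxr (Num.bound r) _)) // leq_addr.
rewrite -[X in _ <= X <= _]invrK lef_pV2 ?posrE ?invr_gt0 //.
rewrite (le_trans (ltW b2)) ?ler_nat //= invrK.
by rewrite (le_trans (ltW b1)) ?ler_nat.
Qed.

Section Singular.
Context {R : realType}.
Implicit Types (s x y r : R).

(** The derivative of [- 1 / (s (1 + r^s))], a bounded function: of size [r^(s-1)] near 0 and
    [r^(-s-1)] at infinity, hence integrable at both ends. *)
Definition bump s r : R := r `^ (s - 1) / (1 + r `^ s) ^+ 2.

Lemma bump_ge0 s r : 0 <= bump s r.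
Proof. by rewrite divr_ge0 ?powR_ge0 ?exprn_ge0 ?addr_ge0 ?powR_ge0. Qed.

Lemma bump_gt0 s r : 0 < r -> 0 < bump s r.
Proof.
by move=> r0; rewrite divr_gt0 ?powR_gt0 ?exprn_gt0 ?ltr_pwDl ?powR_ge0.
Qed.

Definition bump_prim s r : R := - (s * (1 + r `^ s))^-1.

Lemma bump_prim_bound s u v : 0 < s -> bump_prim s u - bump_prim s v <= s^-1.
Proof.
move=> s0; rewrite /bump_prim opprK.
have p r : 1 <= 1 + r `^ s by rewrite lerDl powR_ge0.
have pp r : 0 < 1 + r `^ s by exact: lt_le_trans (p r).
rewrite -[leRHS]add0r lerD //.
  by rewrite oppr_le0 invr_ge0 mulr_ge0 // ltW.
by rewrite lef_pV2 ?posrE ?mulr_gt0 // ler_peMr // ltW.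
Qed.

Lemma is_derive_bump_prim s r : 0 < s -> 0 < r ->
  is_derive r 1 (bump_prim s) (bump s r).
Proof.
move=> s0 r0.
have nz : s * (1 + r `^ s) != 0.
  by rewrite mulf_neq0 ?gt_eqF // ltr_pwDl ?powR_ge0.
have d1 := is_derive1_powR s r0.
have d2 : is_derive r 1 (fun u => s * (1 + u `^ s)) (s * (s * r `^ (s - 1))).
  have := is_deriveZ s (is_deriveD (is_derive_cst (1 : R^o) r 1) d1).
  by rewrite add0r.
have d3 := @is_deriveV _ (fun u => s * (1 + u `^ s)) r _ 1 nz d2.
have d4 : is_derive r 1 (bump_prim s) _ := is_deriveN d3.
apply: (is_derive_eq d4).
rewrite /bump -[_ *: _]/(_ * _); field.
by have := nz; rewrite mulf_eq0 negb_or => /andP[-> ->].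
Qed.

Lemma measurable_bump s : measurable_fun setT (bump s).
Proof.
rewrite (_ : bump s = fun r => r `^ (s - 1) * (1 + r `^ s) `^ (- 2%:R)); last first.
  by apply/funext => r; rewrite powRN powR_mulrn ?addr_ge0 ?powR_ge0.
apply: measurable_funM; first exact: measurable_powR.
apply: (measurableT_comp (measurable_powR _)).
by apply: measurable_funD => //; exact: measurable_powR.
Qed.

Lemma continuous_bump s r : 0 < r -> {for r, continuous (bump s)}.
Proof.
move=> r0.
have c p u : 0 < u -> {for u, continuous (fun v : R => v `^ p)}.
  move=> u0; apply: differentiable_continuous; apply/derivable1_diffP.
  by have [] := is_derive1_powR p u0.
have p0 : 0 < 1 + r `^ s by rewrite ltr_pwDl ?powR_ge0.
apply: cvgM; first exact: c.
apply: cvgV; first by rewrite expf_neq0 ?gt_eqF.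
by apply: cvgM; apply: cvgD; [exact: cvg_cst|exact: c|exact: cvg_cst|exact: c].
Qed.

(* With the value [+oo] at [0], bounds by products of [kern s] of the coordinates hold
   everywhere, coordinate hyperplanes included. *)
Definition kern s r : \bar R := if r == 0 then +oo%E else (bump s `|r|)%:E.

Lemma kern_gt0 s r : (0 < kern s r)%E.
Proof.
by rewrite /kern; case: eqVneq => // r0; rewrite lte_fin bump_gt0 ?normr_gt0.
Qed.

Lemma measurable_kern s x : measurable_fun setT (fun y => kern s (x - y)).
Proof.
have mB : measurable_fun setT (fun y : measurableTypeR R => x - y).
  exact: measurable_funB.
apply: measurable_fun_ifT; first exact: measurable_fun_eqr.
  exact: measurable_cst.
apply/measurable_EFinP; apply: (measurableT_comp (measurable_bump s)).
exact: measurableT_comp.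
Qed.

Lemma integral_kern_lt_pinfty s x : 0 < s ->
  (\int[lebesgue_measure]_y kern s (x - y) < +oo)%E.
Proof.
move=> s0.
pose A := \bigcup_k `[x + k.+2%:R^-1, x + k.+2%:R]%classic.
pose B := \bigcup_k `[x - k.+2%:R, x - k.+2%:R^-1]%classic.
have p k : 0 < k.+2%:R^-1 :> R by rewrite invr_gt0.
have lt k : k.+2%:R^-1 < k.+2%:R :> R.
  by rewrite (@lt_trans _ _ 1) // ?ltr1n // invf_lt1 // ltr1n.
have AE : A = `]x, +oo[%classic.
  apply/seteqP; split=> y /=; rewrite in_itv /= andbT.
    by move=> [k _] /=; rewrite in_itv /= => /andP[+ _]; apply: lt_le_trans; rewrite ltrDl.
  rewrite -subr_gt0 => /exists_nat_between [k /andP[k1 k2]]; exists k => //=.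
  by rewrite in_itv /= -lerBrDl k1 -lerBlDl.
have BE : B = `]-oo, x[%classic.
  apply/seteqP; split=> y /=; rewrite in_itv /=.
    move=> [k _] /=; rewrite in_itv /= => /andP[_ /le_lt_trans]; apply.
    by rewrite ltrBlDr ltrDl.
  rewrite -subr_gt0 => /exists_nat_between [k /andP[k1 k2]]; exists k => //=.
  by rewrite in_itv /= lerBlDr addrC -lerBlDr k2 lerBrDr addrC -lerBrDr.
have iA : (\int[lebesgue_measure]_(y in A) kern s (x - y) <= s^-1%:E)%E.
  rewrite (eq_integral (fun y : measurableTypeR R => (bump s (y - x))%:E)); last first.
    move=> y; rewrite AE inE /= in_itv /= andbT => xy.
    by rewrite /kern subr_eq0 lt_eqF // distrC gtr0_norm // subr_gt0.
  have yA k y : y \in `[x + k.+2%:R^-1, x + k.+2%:R] -> 0 < y - x.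
    by rewrite in_itv /= => /andP[+ _]; rewrite subr_gt0; apply: lt_le_trans; rewrite ltrDl.
  apply: (@le_integral_bigcup_derivative _ _ _ (fun y => bump_prim s (y - x))).
  - by move=> k; rewrite ltrD2l.
  - move=> k l kl; rewrite subsetEset => y /=; rewrite !in_itv /= => /andP[y1 y2].
    rewrite (le_trans _ y1) ?(le_trans y2) // lerD2l ?ler_nat // lef_pV2 ?posrE //.
    by rewrite ler_nat.
  - move=> k y /yA r0; have d := is_derive_bump_prim s0 r0.
    by have := is_derive1_comp (is_derive_shift y 1 (- x)) d; rewrite mulr1.
  - move=> k y /yA r0.
    apply: (@continuous_comp _ _ _ (fun y => y - x) (bump s)).
      by apply: cvgB; [exact: cvg_id|exact: cvg_cst].
    exact: continuous_bump.
  - by move=> k y /yA r0; exact: bump_ge0.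
  - by move=> u v; exact: bump_prim_bound.
have iB : (\int[lebesgue_measure]_(y in B) kern s (x - y) <= s^-1%:E)%E.
  rewrite (eq_integral (fun y : measurableTypeR R => (bump s (x - y))%:E)); last first.
    move=> y; rewrite BE inE /= in_itv /= => xy.
    by rewrite /kern subr_eq0 gt_eqF // gtr0_norm // subr_gt0.
  have yB k y : y \in `[x - k.+2%:R, x - k.+2%:R^-1] -> 0 < x - y.
    rewrite in_itv /= => /andP[_]; rewrite subr_gt0 => /le_lt_trans; apply.
    by rewrite ltrBlDr ltrDl.
  apply: (@le_integral_bigcup_derivative _ _ _ (fun y => - bump_prim s (x - y))).
  - by move=> k; rewrite ltrD2l ltrN2.
  - move=> k l kl; rewrite subsetEset => y /=; rewrite !in_itv /= => /andP[y1 y2].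
    rewrite (le_trans _ y1) ?(le_trans y2) // lerD2l lerN2 ?ler_nat // lef_pV2 ?posrE //.
    by rewrite ler_nat.
  - move=> k y /yB r0; have d := is_derive_bump_prim s0 r0.
    have dB : is_derive y 1 (fun y => x - y) (-1).
      have := is_deriveB (is_derive_cst (x : R^o) y 1) (is_derive_id y 1).
      by rewrite sub0r.
    have := is_deriveN (is_derive1_comp dB d).
    by move=> D; apply: (is_derive_eq D); rewrite mulrN1 opprK.
  - move=> k y /yB r0.
    apply: (@continuous_comp _ _ _ (fun y => x - y) (bump s)).
      by apply: cvgB; [exact: cvg_cst|exact: cvg_id].
    exact: continuous_bump.
  - by move=> k y /yB r0; exact: bump_ge0.
  - move=> u v; have := @bump_prim_bound s (x - v) (x - u) s0; lra.
have mK := measurable_kern s x.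
(* The point [x], where the integrand is [+oo], is a null set. *)
have -> : [set: R] = (B `|` A) `|` [set x].
  apply/seteqP; split=> // y _; rewrite AE BE /= !in_itv /= andbT.
  by case: (ltgtP x y) => [||->]; [left; right|left; left|right].
have mA : measurable (A : set (measurableTypeR R)) by rewrite AE; exact: measurable_itv.
have mB : measurable (B : set (measurableTypeR R)) by rewrite BE; exact: measurable_itv.
have k0 y : (0 <= kern s (x - y))%E by rewrite ltW // kern_gt0.
rewrite !ge0_integral_setU //=.
- rewrite integral_set1 adde0 lte_add_pinfty //.
    by rewrite (le_lt_trans iB) ?ltry.
  by rewrite (le_lt_trans iA) ?ltry.
- exact: measurable_funS mK.
- apply/disj_setPS => y; rewrite AE BE /= !in_itv /= andbT => -[y1 y2].
  by have := lt_trans y1 y2; rewrite ltxx.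
- exact: measurableU.
- exact: measurable_funS mK.
- apply/disj_setPS => y; rewrite AE BE /= !in_itv /= andbT => -[+ yx].
  by rewrite yx ltxx => -[].
Qed.

End Singular.

(** * Tonelli's theorem and weights on tuples *)

Section TupleIntegral.
Context {R : realType}.
Notation Rm := (measurableTypeR R).

Lemma measurable_prod_tnth n (g : 'I_n -> Rm -> \bar R) :
  (forall i, measurable_fun setT (g i)) ->
  measurable_fun setT (fun t : n.-tuple Rm => \big[mule/1%E]_(i < n) g i (tnth t i)).
Proof.
move=> mg; elim: n => [|n IHn] in g mg *.
  by under eq_fun do rewrite big_ord0; exact: measurable_cst.
under eq_fun do rewrite big_ord_recl.
apply: emeasurable_funM.
  exact: (measurableT_comp (mg ord0) (measurable_tnth ord0)).
have -> : (fun t : n.+1.-tuple Rm =>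
    \big[mule/1%E]_(i < n) g (lift ord0 i) (tnth t (lift ord0 i))) =
  (fun t : n.-tuple Rm => \big[mule/1%E]_(i < n) g (lift ord0 i) (tnth t i)) \o
  (fun t : n.+1.-tuple Rm => [tuple of behead t]).
  apply/funext => t /=; apply: eq_bigr => i _; congr (g _ _).
  by rewrite tnth_behead; congr (tnth t _); apply/val_inj; rewrite /= inordK // ltnS.
exact: (measurableT_comp (IHn _ (fun i => mg (lift ord0 i))) (@measurable_behead _ Rm n)).
Qed.

Lemma prode_ge0 (I : Type) (r : seq I) (P : pred I) (F : I -> \bar R) :
  (forall i, P i -> 0 <= F i)%E -> (0 <= \big[mule/1%E]_(i <- r | P i) F i)%E.
Proof.
by move=> F0; apply: (big_ind (fun x => 0 <= x)%E) => //; exact: mule_ge0.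
Qed.

Lemma integral_lebesgue_tuple_prod n (g : 'I_n -> Rm -> \bar R) :
  (forall i, measurable_fun setT (g i)) -> (forall i r, 0 <= g i r)%E ->
  (\int[lebesgue_tuple n]_t \big[mule/1%E]_(i < n) g i (tnth t i) =
   \big[mule/1%E]_(i < n) \int[lebesgue_measure]_r g i r)%E.
Proof.
move=> mg g0; elim: n => [|n IHn] in g mg g0 *.
  under eq_integral do rewrite big_ord0.
  by rewrite big_ord0 integral_cst // mul1e; apply: diracT.
have mG := measurable_prod_tnth mg.
(* [lebesgue_tuple n.+1] is this pushforward by definition; Tonelli splits off the first coordinate
   and the induction hypothesis evaluates the inner integral. *)
rewrite [LHS](_ : _ = (\int[pushforward (lebesgue_measure \x lebesgue_tuple n)
  (@tcons R n)]_t \big[mule/1%E]_(i < n.+1) g i (tnth t i)))%E //.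
rewrite ge0_integral_pushforward //=; first last.
- by move=> t _; exact: prode_ge0.
- exact: measurable_tcons.
rewrite preimage_setT fubini_tonelli1; first last.
- by move=> x; exact: prode_ge0.
- exact: (measurableT_comp mG (@measurable_tcons R n)).
rewrite big_ord_recl /fubini_F /=.
have mG' : measurable_fun setT (fun t : n.-tuple Rm =>
    \big[mule/1%E]_(i < n) g (lift ord0 i) (tnth t i)).
  exact: (measurable_prod_tnth (fun i => mg (lift ord0 i))).
under eq_integral => x _.
  under eq_integral => t _.
    rewrite big_ord_recl (_ : tnth _ ord0 = x) //.
    under eq_bigr => i _ do rewrite (_ : tnth _ (lift ord0 i) = tnth t i) ?tnthS //.
    over.
  rewrite ge0_integralZl //; last by move=> t _; exact: prode_ge0.
  rewrite (IHn (fun i => g (lift ord0 i))) //.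
  rewrite muleC.
  over.
rewrite ge0_integralZl //; first by rewrite muleC.
by apply: prode_ge0 => i _; exact: integral_ge0.
Qed.

End TupleIntegral.

Section Weights.
Context {R : realType} {n : nat}.
Implicit Types (x y : 'rV[R]_n) (p : R).

Lemma enorm_ge0 x : 0 <= enorm x.
Proof. exact: sqrtr_ge0. Qed.

Lemma enorm_sqr x : enorm x ^+ 2 = \sum_i x 0 i ^+ 2.
Proof. by rewrite sqr_sqrtr // sumr_ge0 // => i _; exact: sqr_ge0. Qed.

Lemma ler_norm_enorm x i : `|x 0 i| <= enorm x.
Proof.
rewrite -ler_sqr ?nnegrE ?enorm_ge0 // enorm_sqr real_normK ?num_real //.
by rewrite (bigD1 i) //= lerDl sumr_ge0 // => j _; exact: sqr_ge0.
Qed.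

Lemma enorm_eq0 x : (enorm x == 0) = (x == 0).
Proof.
apply/eqP/eqP => [x0|->]; last first.
  by rewrite /enorm big1 ?sqrtr0 // => i _; rewrite mxE expr0n.
apply/rowP => i; rewrite mxE; apply/normr0_eq0/le_anti.
by rewrite normr_ge0 andbT -x0 ler_norm_enorm.
Qed.

Lemma enorm_gt0 x : (0 < enorm x) = (x != 0).
Proof. by rewrite lt_neqAle enorm_ge0 andbT eq_sym enorm_eq0. Qed.

Lemma weight_sqr x : weight x ^+ 2 = 1 + enorm x ^+ 2.
Proof. by rewrite sqr_sqrtr // addr_ge0 // sqr_ge0. Qed.

Lemma weight_ge1 x : 1 <= weight x.
Proof. by rewrite -[leLHS]sqrtr1 ler_sqrt ?lerDl ?sqr_ge0 // addr_ge0 // sqr_ge0. Qed.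

Lemma weight_gt0 x : 0 < weight x.
Proof. exact: lt_le_trans (weight_ge1 x). Qed.

Lemma weight_ge0 x : 0 <= weight x.
Proof. exact/ltW/weight_gt0. Qed.

Lemma enorm_le_weight x : enorm x <= weight x.
Proof.
rewrite -ler_sqr ?nnegrE ?enorm_ge0 ?weight_ge0 // weight_sqr.
by rewrite lerDr.
Qed.

Lemma weight_sub x y : weight (x - y) <= 2 * weight x * weight y.
Proof.
rewrite -ler_sqr ?nnegrE ?mulr_ge0 ?weight_ge0 // !exprMn !weight_sqr.
have : enorm (x - y) ^+ 2 <= 2 * enorm x ^+ 2 + 2 * enorm y ^+ 2.
  rewrite !enorm_sqr !mulr_sumr -big_split /=; apply: ler_sum => i _.
  rewrite !mxE; have := sqr_ge0 (x 0 i + y 0 i); nra.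
have := sqr_ge0 (enorm x); have := sqr_ge0 (enorm y); nra.
Qed.

(** A Peetre inequality: decay in [y] becomes decay in [x - y] at the price of a factor depending on
    [x] alone, so that the majorant is a translate of a fixed function. *)
Lemma weight_sub_powRN x y p : 0 <= p ->
  weight y `^ (- p) <= (2 * weight x) `^ p * weight (x - y) `^ (- p).
Proof.
move=> p0; have w z := weight_gt0 z.
rewrite !powRN ler_pdivlMr ?powR_gt0 // mulrC ler_pdivrMr ?powR_gt0 //.
rewrite -powRM ?mulr_ge0 ?weight_ge0 //; apply: ge0_ler_powR => //.
- by rewrite nnegrE weight_ge0.
- by rewrite nnegrE !mulr_ge0 ?weight_ge0.
- exact: weight_sub.
Qed.

End Weights.

(** * Measurability of continuous functions on R^n *)

Section Measurability.
Context {R : realType} {n : nat}.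
Notation Rm := (measurableTypeR R).

Lemma cvg_row (I : Type) (F : set_system I) {FF : Filter F} (f : I -> 'rV[R]_n)
    (y : 'rV[R]_n) :
  (forall i, f t 0 i @[t --> F] --> y 0 i) -> f t @[t --> F] --> y.
Proof.
move=> fy A [P yP PA].
have : \forall t \near F, forall ij : 'I_1 * 'I_n, P ij.1 ij.2 (f t ij.1 ij.2).
  apply: filter_forall => -[i j] /=; rewrite (ord1 i).
  exact: (fy j) (yP 0 j).
by apply: filterS => t Pt; apply: PA => i j; exact: Pt (i, j).
Qed.

Let cell k (z : {ffun 'I_n -> int}) : 'rV[R]_n := \row_i ((z i)%:~R / k.+1%:R).

Let index k (t : n.-tuple Rm) : {ffun 'I_n -> int} :=
  [ffun i => Num.floor (k.+1%:R * tnth t i)].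

Let measurable_index k z : measurable [set t | index k t = z].
Proof.
have -> : [set t | index k t = z] = \bigcap_(i : 'I_n)
    ((fun t : n.-tuple Rm => k.+1%:R * tnth t i) @^-1`
      `[(z i)%:~R, (z i)%:~R + 1[%classic).
  apply/seteqP; split=> t /=.
    move=> tz i _ /=; rewrite in_itv /= -tz ffunE.
    by rewrite floor_le_tmp -intrD1 floorD1_gt.
  move=> tz; apply/ffunP => i; rewrite ffunE.
  apply/eqP; rewrite floor_eq.
  by have := tz i I; rewrite /= in_itv /= -intrD1.
apply: fin_bigcap_measurable => [|i _]; first exact: finite_finset.
rewrite -[X in measurable X]setTI.
by apply: measurable_funM => //; exact: measurable_tnth.
Qed.

(* [g] is the pointwise limit of its step interpolations on finer and finer grids. *)
Lemma continuous_measurable_row (g : 'rV[R]_n -> R) :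
  continuous g -> measurable_fun setT (g \o @row_of_tuple R n).
Proof.
move=> cg; apply: (measurable_fun_cvg (h := fun k t => g (cell k (index k t)))).
  move=> k _ B mB; rewrite setTI.
  (* The interpolation is constant on the cells of the grid, which are countably many and measurable
     for the product sigma-algebra of tuples. *)
  have -> : (fun t => g (cell k (index k t))) @^-1` B =
      \bigcup_z (if g (cell k z) \in B then [set t | index k t = z] else set0).
    apply/seteqP; split=> t /=.
      by move=> Bt; exists (index k t) => //; rewrite mem_set.
    by move=> [z _]; case: ifPn => // /set_mem Bz /= ->.
  apply: countable_bigcupT_measurable; first exact: countableP.
  by move=> z; case: ifP => // _; exact: measurable_index.
move=> t _.
suff c : cell k (index k t) @[k --> \oo] --> row_of_tuple t by exact: (cvg_comp _ _ c (cg _)).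
apply: (@cvg_row _ \oo _ (fun k => cell k (index k t))) => i.
rewrite [X in _ --> X]mxE.
apply/cvgrPdist_le => e e0.
have he : \forall k \near \oo, k.+1%:R^-1 <= e :> R.
  have := near_infty_natSinv_lt (PosNum e0).
  by apply: filterS => k /ltW.
apply: filterS he => k ke; rewrite mxE ffunE; apply: le_trans ke.
set u := tnth t i; set v := Num.floor _.
have k0 : 0 < k.+1%:R :> R by [].
have v1 : v%:~R <= k.+1%:R * u by exact: floor_le_tmp.
have v2 : k.+1%:R * u < v%:~R + 1 by rewrite -intrD1 floorD1_gt.
rewrite -(ler_pM2l k0) mulfV ?gt_eqF // -[X in X * `|_|]gtr0_norm // -normrM.
rewrite mulrBr mulrCA mulfV ?gt_eqF // mulr1 ger0_norm ?subr_ge0 //.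
by rewrite lerBlDl ltW.
Qed.

End Measurability.

(** * A product majorant for radial singularities *)

Section Majorant.
Context {R : realType}.
Implicit Types s u v : R.

Lemma one_powR s : 1 `^ s = 1 :> R.
Proof. by rewrite powR1. Qed.

(** For [s <= 1] the power and the inverse square both decrease. *)
Lemma bump_nonincreasing s u v : 0 < s <= 1 -> 0 < u -> u <= v ->
  bump s v <= bump s u.
Proof.
move=> /andP[s0 s1] u0 uv; have v0 := lt_le_trans u0 uv.
have uvs : u `^ s <= v `^ s by apply: ge0_ler_powR; rewrite ?nnegrE // ltW.
apply: ler_pM; rewrite ?powR_ge0 ?invr_ge0 ?exprn_ge0 ?addr_ge0 ?powR_ge0 //.
  rewrite -(opprB 1 s) !powRN lef_pV2 ?posrE ?powR_gt0 //.
  by apply: ge0_ler_powR; rewrite ?nnegrE ?subr_ge0 // ltW.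
by rewrite lef_pV2 ?posrE ?exprn_gt0 ?ltr_pwDl ?powR_ge0 // lerXn2r ?nnegrE
  ?addr_ge0 ?powR_ge0 // lerD2l.
Qed.

(** Here [u^s <= 1] and the denominator is at most 4; for [u >= 1] it is at most [4 u^(2s)], whence
    the same constant in the next lemma. *)
Lemma bump_ge_small s u : 0 <= s -> 0 < u <= 1 -> u `^ (s - 1) / 4 <= bump s u.
Proof.
move=> s0 /andP[u0 u1]; rewrite /bump ler_wpM2l ?powR_ge0 //.
rewrite lef_pV2 ?posrE ?exprn_gt0 ?ltr_pwDl ?powR_ge0 //.
have us : u `^ s <= 1.
  by rewrite -(one_powR s); apply: ge0_ler_powR; rewrite ?nnegrE // ltW.
have := powR_ge0 u s; nra.
Qed.

Lemma bump_ge_large s u : 0 <= s -> 1 <= u -> u `^ (- s - 1) / 4 <= bump s u.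
Proof.
move=> s0 u1; have u0 : 0 < u by exact: lt_le_trans u1.
have us : 1 <= u `^ s.
  by rewrite -(one_powR s); apply: ge0_ler_powR; rewrite ?nnegrE // ltW.
rewrite /bump.
have -> : u `^ (- s - 1) = u `^ (s - 1) * (u `^ s * u `^ s)^-1.
  have nz : u != 0 by rewrite gt_eqF.
  by rewrite -powRD ?nz ?implybT // -powRN -powRD ?nz ?implybT //; congr (_ `^ _); ring.
rewrite -mulrA ler_wpM2l ?powR_ge0 // -invfM.
rewrite lef_pV2 ?posrE ?exprn_gt0 ?mulr_gt0 ?ltr_pwDl ?powR_gt0 ?powR_ge0 //.
nra.
Qed.

Lemma powRXn u s n : (u `^ s) ^+ n = u `^ (s * n%:R).
Proof. by rewrite powRrM powR_mulrn ?powR_ge0. Qed.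

(** Decay of order [p] at infinity times the singularity of a first derivative of the fundamental
    solution. The maximum with 1 lets the same profile serve for kernels without decay, such as
    polynomials. *)
Definition sing_weight n (p : R) (r : 'rV[R]_n) : R :=
  weight r `^ (- p) * Num.max 1 (enorm r `^ (1 - n%:R)).

Lemma sing_weight_le_kern n (p : R) : (0 < n)%N -> n%:R < p ->
  exists s C : R, [/\ 0 < s, 0 < C & forall r : 'rV[R]_n,
    ((sing_weight p r)%:E <= C%:E * \big[mule/1%E]_(i < n) kern s (r 0%R i))%E].
Proof.
move=> n0 np; have n0' : 0 < n%:R :> R by rewrite ltr0n.
have n1 : 1 <= n%:R :> R by rewrite ler1n.
(* The first term gives [|r|^(1-n) <= |r|^(n(s-1))] for [|r| <= 1], the second gives
   [|r|^(-p) <= |r|^(-n(s+1))] for [|r| >= 1]; it is positive because [p > n]. *)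
pose s : R := Num.min n%:R^-1 (p / n%:R - 1).
have s0 : 0 < s by rewrite lt_min invr_gt0 n0' subr_gt0 ltr_pdivlMr ?mul1r.
have sn : s * n%:R <= 1.
  by rewrite -ler_pdivlMr // mul1r ge_min lexx.
have sp : (s + 1) * n%:R <= p.
  by rewrite -ler_pdivlMr // -lerBrDr ge_min lexx orbT.
have s1 : s <= 1.
  by rewrite (le_trans _ sn) // ler_peMr // ltW.
(* Each of the [n] factors [bump] loses a factor 4 against the pure power. *)
exists s, (4 ^+ n); split=> // r.
have [/existsP[i /eqP ri]|/existsPn rn0] := boolP [exists i, r 0 i == 0].
  rewrite (bigD1 i) //= ri {1}/kern eqxx gt0_mulye; last first.
    by apply: (big_ind (fun x => 0 < x)%E) => // [a b|j _]; [exact: mule_gt0|exact: kern_gt0].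
  by rewrite gt0_muley ?lte_fin // leey.
have rr0 : 0 < enorm r.
  by rewrite (lt_le_trans _ (ler_norm_enorm r (Ordinal n0))) // normr_gt0 rn0.
have pE : (\big[mule/1%E]_(i < n) kern s (r 0%R i) =
    (\prod_(i < n) bump s `|r 0%R i|)%:E)%E.
  rewrite -prodEFin; apply: eq_bigr => i _.
  by rewrite /kern ifN.
rewrite pE -EFinM lee_fin.
have pb : bump s (enorm r) ^+ n <= \prod_(i < n) bump s `|r 0 i|.
  rewrite -[X in _ ^+ X]card_ord -prodr_const; apply: ler_prod => i _.
  rewrite bump_ge0 /= bump_nonincreasing ?s0 // ?normr_gt0 ?rn0 //.
  exact: ler_norm_enorm.
apply: le_trans (ler_wpM2l _ pb); last by rewrite exprn_ge0.
rewrite -exprMn.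
have w1 := weight_ge1 r; have w0 := weight_gt0 r.
have p0 : 0 <= p by rewrite (le_trans _ (ltW np)) // ltW.
have le_b (x : R) : 0 <= x -> x / 4 <= bump s (enorm r) ->
    x ^+ n <= (4 * bump s (enorm r)) ^+ n.
  move=> x0 xb; apply: lerXn2r => //.
    by rewrite nnegrE mulr_ge0 ?bump_ge0.
  by rewrite mulrC -ler_pdivrMr.
rewrite /sing_weight.
have [r1|r1] := leP (enorm r) 1.
  apply: le_trans (le_b _ (powR_ge0 _ _) (bump_ge_small (ltW s0) _)); last by rewrite rr0.
  rewrite powRXn.
  have wp1 : weight r `^ (- p) <= 1.
    rewrite powRN invf_le1 ?powR_gt0 // -(one_powR p).
    by apply: ge0_ler_powR; rewrite ?nnegrE // ltW.
  have dec (a b : R) : a <= b -> enorm r `^ b <= enorm r `^ a.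
    by move=> ab; apply: ger_powR => //; rewrite rr0.
  have m1 : Num.max 1 (enorm r `^ (1 - n%:R)) <= enorm r `^ ((s - 1) * n%:R).
    rewrite ge_max; apply/andP; split; last first.
      by apply: dec; rewrite mulrBl mul1r lerD2r.
    have := dec ((s - 1) * n%:R) 0; rewrite powRr0; apply.
    by rewrite mulr_le0_ge0 ?subr_le0 // ltW.
  by rewrite -[leRHS]mul1r; apply: ler_pM => //; exact: powR_ge0.
apply: le_trans (le_b _ (powR_ge0 _ _) (bump_ge_large (ltW s0) (ltW r1))).
rewrite powRXn.
have m1 : Num.max 1 (enorm r `^ (1 - n%:R)) <= 1.
  rewrite ge_max lexx /=; have := @ler_powR _ (enorm r) (ltW r1) (1 - n%:R) 0.
  by rewrite powRr0; apply; rewrite subr_le0.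
apply: (@le_trans _ _ (enorm r `^ (- p))); last first.
  apply: ler_powR; first exact: ltW.
  by rewrite -opprD mulNr lerN2.
rewrite -[leRHS]mulr1; apply: ler_pM => //; first exact: powR_ge0.
rewrite !powRN lef_pV2 ?posrE ?powR_gt0 //.
by apply: ge0_ler_powR; rewrite ?nnegrE ?enorm_le_weight // ltW.
Qed.

Lemma integrable_sing_weight n (p C : R) (x : 'rV[R]_n) (g : 'rV[R]_n -> R) :
  (0 < n)%N -> n%:R < p -> 0 <= C ->
  measurable_fun setT (g \o @row_of_tuple R n) ->
  (forall y, y != x -> `|g y| <= C * sing_weight p (x - y)) ->
  (lebesgue_tuple n).-integrable setT (EFin \o (g \o @row_of_tuple R n)).
Proof.
move=> n0 np C0 mg gC.
have [s [D [s0 D0 sD]]] := sing_weight_le_kern n0 np.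
pose G (t : n.-tuple (measurableTypeR R)) :=
  (\big[mule/1%E]_(i < n) kern s (x 0%R i - tnth t i))%E.
have mG : measurable_fun setT G.
  exact: (measurable_prod_tnth (fun i => measurable_kern s (x 0 i))).
have iG : (lebesgue_tuple n).-integrable setT G.
  apply/integrableP; split=> //.
  under eq_integral => t _.
    rewrite gee0_abs; last first.
      by apply: prode_ge0 => i _; exact/ltW/kern_gt0.
    over.
  rewrite (integral_lebesgue_tuple_prod (fun i => measurable_kern s (x 0 i))); last first.
    by move=> i r; exact/ltW/kern_gt0.
  have : (0 <= \big[mule/1]_(i < n) \int[lebesgue_measure]_r kern s (x 0%R i - r) < +oo)%E.
    apply: (big_ind (fun z => 0 <= z < +oo)%E) => [|a b /andP[a0 aoo] /andP[b0 boo]|i _].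
    - by rewrite lee01 ltry.
    - by rewrite mule_ge0 // lte_mul_pinfty // ge0_fin_numE.
    - rewrite integral_kern_lt_pinfty // andbT.
      by apply: integral_ge0 => r _; exact/ltW/kern_gt0.
  by case/andP.
(* With [C + 1] the factor is positive even if [C = 0], so the majorant is [+oo] at the point [x],
   where nothing is known about [g]. *)
have iG' := integrableZl measurableT ((C + 1) * D) iG.
apply: (le_integrable _ _ _ iG') => //; first exact/measurable_EFinP.
move=> t _ /=.
have G0 : (0 < G t)%E.
  by apply: (big_ind (fun x => 0 < x)%E) => // [a b|i _]; [exact: mule_gt0|exact: kern_gt0].
have CD : 0 < (C + 1) * D by rewrite mulr_gt0 // ltr_wpDl.
rewrite gee0_abs; last by apply: mule_ge0; [rewrite lee_fin|]; exact: ltW.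
have [tx|tx] := eqVneq (row_of_tuple t) x.
  have -> : G t = +oo%E.
    rewrite /G (bigD1 (Ordinal n0)) //= -tx mxE subrr {1}/kern eqxx gt0_mulye //.
    by apply: (big_ind (fun x => 0 < x)%E) => // [a b|i _]; [exact: mule_gt0|exact: kern_gt0].
  by rewrite gt0_muley ?lte_fin // leey.
rewrite EFinM -muleA.
have sG : ((sing_weight p (x - row_of_tuple t))%:E <= D%:E * G t)%E.
  apply: le_trans (sD _) _; rewrite le_eqVlt; apply/orP; left; apply/eqP; congr (_ * _)%E.
  by apply: eq_bigr => i _; rewrite !mxE.
apply: (@le_trans _ _ (C%:E * (sing_weight p (x - row_of_tuple t))%:E)%E).
  by rewrite -EFinM lee_fin gC.
apply: lee_pmul; rewrite ?lee_fin ?lerDl //.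
by rewrite mulr_ge0 ?powR_ge0 // le_max ler01.
Qed.

End Majorant.

(** * Derivatives in time *)

Section TimeDerivative.
Context {R : realType}.
Variable T : R.
Hypothesis T0 : 0 < T.
Implicit Types (a b : R -> R) (t tau l : R).

(** Uniqueness of the limit defining [tderiv], one-sided at the end points, rests on this. *)
Lemma within_itv_dnbhs_proper t : t \in `[0, T] -> ProperFilter (within `[0, T]%classic t^').
Proof.
rewrite in_itv /= => /andP[t0 tT]; split; last exact: within_filter.
move=> /nbhs_ballP[e /= e0 /= teP].
(* [d < e] keeps the test point in the ball; [d <= T / 2] keeps it in the interval if the step is
   taken towards the farther end point. *)
pose d := Num.min e T / 2.
have d0 : 0 < d by rewrite divr_gt0 // lt_min e0.
have de : d < e.
  by rewrite ltr_pdivrMr // (le_lt_trans (_ : _ <= e)) ?ge_min ?lexx // mulr_natr mulr2n ltrDl.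
have dT : d <= T / 2 by rewrite ler_pM2r ?invr_gt0 // ge_min lexx orbT.
have [tT2|tT2] := leP t (T / 2).
  apply: (teP (t + d)) => /=.
  - by rewrite /ball /= opprD addrA subrr sub0r normrN gtr0_norm.
  - by rewrite gt_eqF // ltrDl.
  - by rewrite in_itv /=; apply/andP; split; lra.
apply: (teP (t - d)) => /=.
- by rewrite /ball /= opprD opprK addrA subrr add0r gtr0_norm.
- by rewrite lt_eqF // gtrDl oppr_lt0.
- by rewrite in_itv /=; apply/andP; split; lra.
Qed.

Lemma tderiv_cvg a t l : t \in `[0, T] -> tquot a t @ within `[0, T]%classic t^' --> l ->
  tderivable T a t /\ tderiv T a t = l.
Proof.
move=> tT al; have ? := within_itv_dnbhs_proper tT.
by split; [apply/cvg_ex; exists l|exact/cvg_lim].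
Qed.

Lemma near_tquot_eq a b t : t \in `[0, T] ->
  (forall tau, tau \in `[0, T] -> a tau = b tau) ->
  \forall tau \near within `[0, T]%classic t^', tquot a t tau = tquot b t tau.
Proof.
move=> tT ab; rewrite /= near_withinE; near=> tau => tauT.
by rewrite /tquot !ab.
Unshelve. all: by end_near. Qed.

(** Iterated time derivatives are identified at times in [[0, T]] only, and the limit within this
    interval sees no other times. *)
Lemma eq_tquot_cvg a b t l : t \in `[0, T] ->
  (forall tau, tau \in `[0, T] -> a tau = b tau) ->
  tquot b t @ within `[0, T]%classic t^' --> l ->
  tquot a t @ within `[0, T]%classic t^' --> l.
Proof.
move=> tT ab; apply: cvg_trans; apply: near_eq_cvg.
by apply: near_tquot_eq => // tau /ab.
Qed.

Lemma powR_small (mu C e : R) : 0 < mu -> 0 <= C -> 0 < e ->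
  exists2 d, 0 < d & forall r, 0 <= r <= d -> C * r `^ mu <= e.
Proof.
move=> mu0 C0 e0; have C1 : 0 < C + 1 by rewrite ltr_wpDl.
exists ((e / (C + 1)) `^ mu^-1); first by rewrite powR_gt0 // divr_gt0.
move=> r /andP[r0 rd].
have : r `^ mu <= e / (C + 1).
  have <- : ((e / (C + 1)) `^ mu^-1) `^ mu = e / (C + 1).
    by rewrite -powRrM mulVf ?gt_eqF // powRr1 // divr_ge0 // ltW.
  by apply: ge0_ler_powR; rewrite ?nnegrE ?powR_ge0 // ltW.
rewrite ler_pdivlMr // mulrC; apply: le_trans.
by rewrite ler_wpM2r ?powR_ge0 // lerDl.
Qed.

Lemma hoelder_continuous_within (mu C : R) a : 0 < mu -> 0 <= C ->
  (forall t tau, t \in `[0, T] -> tau \in `[0, T] ->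
     `|a t - a tau| <= C * `|t - tau| `^ mu) ->
  {within `[0, T], continuous a}.
Proof.
move=> mu0 C0 aC; apply/subspace_continuousP => t tT.
apply/cvgrPdist_le => e e0; have [d d0 dC] := powR_small mu0 C0 e0.
rewrite near_withinE; near=> tau => tauT.
apply: le_trans (aC _ _ tT tauT) _; apply: dC; rewrite normr_ge0 /=.
by near: tau; apply: cvgr_dist_le d0; exact: cvg_id.
Unshelve. all: by end_near. Qed.

Lemma tquot_cvg_is_derive a t l : t \in `]0, T[ ->
  tquot a t @ within `[0, T]%classic t^' --> l -> is_derive t 1 a l.
Proof.
move=> tT al.
have al' : tquot a t tau @[tau --> t^'] --> l.
  apply: cvg_trans al; apply: cvg_app => A PA.
  have tauT : \forall tau \near t^', tau \in `[0, T].
    apply: nbhs_dnbhs; have := near_in_itvoo tT.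
    by apply: filterS => tau; exact: subset_itv_oo_cc.
  by apply: filterS2 tauT PA => tau tauT; exact.
have dl : h^-1 *: (a (h *: 1 + t) - a t) @[h --> 0^'] --> l.
  apply/cvgrPdist_le => e e0.
  move/cvgrPdist_le/(_ _ e0) : al' => /nbhs_ballP[d /= d0 dP].
  apply/nbhs_ballP; exists d => //= h; rewrite /ball /= sub0r normrN => hd h0.
  have := dP (h + t); rewrite /tquot addrK -[_ *: 1]/(_ * 1) mulr1.
  rewrite -[_ *: _]/(_ * _) mulrC; apply.
    by rewrite /ball /= opprD addrCA subrr addr0 normrN.
  by rewrite -subr_eq0 addrK.
by split; [apply/cvg_ex; exists l|exact/cvg_lim].
Qed.

(** In the application [xi] depends on the integration variable; its distance to [t] is all that the
    Hoelder bound asks for. *)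
Lemma tquot_mvt a (a' : R -> R) t tau :
  t \in `[0, T] -> tau \in `[0, T] -> t != tau ->
  {within `[0, T], continuous a} ->
  (forall u, u \in `[0, T] -> tquot a u @ within `[0, T]%classic u^' --> a' u) ->
  exists2 xi, xi \in `[0, T] & tquot a t tau = a' xi /\ `|xi - t| <= `|tau - t|.
Proof.
move=> tT tauT ttau ca da.
have mvt x y : x \in `[0, T] -> y \in `[0, T] -> x < y ->
    exists2 xi, xi \in `]x, y[ & a y - a x = a' xi * (y - x).
  rewrite !in_itv /= => /andP[x0 xT] /andP[y0 yT] xy; apply: MVT => //.
    move=> u /[!in_itv] /= /andP[xu uy].
    have uT : u \in `]0, T[ by rewrite in_itv /= (le_lt_trans x0) // (lt_le_trans uy).
    by apply: tquot_cvg_is_derive => //; apply: da; exact: subset_itv_oo_cc.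
  apply: continuous_subspaceW ca => u /=; rewrite !in_itv /= => /andP[xu uy].
  by rewrite (le_trans x0) // (le_trans uy).
have [tt|tt|tt] := ltgtP t tau; last by rewrite tt eqxx in ttau.
  have [xi /[!in_itv] /= /andP[x1 x2] e] := mvt _ _ tT tauT tt.
  exists xi; move: tT tauT; rewrite !in_itv /= => /andP[? ?] /andP[? ?].
    by apply/andP; split; lra.
  split; first by rewrite /tquot e mulfK // subr_eq0 gt_eqF.
  by rewrite !gtr0_norm ?subr_gt0 // lerB // ltW.
have [xi /[!in_itv] /= /andP[x1 x2] e] := mvt _ _ tauT tT tt.
exists xi; move: tT tauT; rewrite !in_itv /= => /andP[? ?] /andP[? ?].
  by apply/andP; split; lra.
split.
  by rewrite /tquot -(opprB (a t)) e -(opprB t) invrN mulrNN mulfK // subr_eq0 gt_eqF.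
by rewrite !ltr0_norm ?subr_lt0 // !opprB lerD2l lerN2 ltW.
Qed.

(** * Differentiation in time under the integral sign *)

Section Integral.
Context d (Y : measurableType d) (nu : {measure set Y -> \bar R}).
Variables (s : nat) (mu : R) (G : nat -> R -> Y -> R) (M : Y -> R).
Hypothesis mu0 : 0 < mu.
Hypothesis M0 : forall y, 0 <= M y.
Hypothesis iM : nu.-integrable setT (EFin \o M).
Hypothesis iG : forall j t, (j <= s)%N -> t \in `[0, T] ->
  nu.-integrable setT (EFin \o G j t).
Hypothesis GM : forall j t tau y, (j <= s)%N -> t \in `[0, T] -> tau \in `[0, T] ->
  `|G j t y - G j tau y| <= M y * `|t - tau| `^ mu.
Hypothesis dG : forall j t y, (j < s)%N -> t \in `[0, T] ->
  tquot (fun u => G j u y) t @ within `[0, T]%classic t^' --> G j.+1 t y.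

Let A j t : R := Rintegral nu setT (G j t).
Let I : R := Rintegral nu setT M.

Let I0 : 0 <= I. Proof. exact: Rintegral_ge0. Qed.

Let le_Rintegral_M (g : Y -> R) (c : R) : nu.-integrable setT (EFin \o g) ->
  (forall y, `|g y| <= M y * c) -> `|Rintegral nu setT g| <= I * c.
Proof.
move=> ig gM; apply: le_trans (le_normr_Rintegral _ ig) _ => //.
rewrite -RintegralZr //; apply: le_Rintegral => //.
- exact: (integrable_norm ig).
- have := integrableZr measurableT c iM.
  by apply: eq_integrable => // y _.
Qed.

Let hoelder_A j t tau : (j <= s)%N -> t \in `[0, T] -> tau \in `[0, T] ->
  `|A j t - A j tau| <= I * `|t - tau| `^ mu.
Proof.
move=> js tT tauT; rewrite -RintegralB ?iG //; apply: le_Rintegral_M.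
  have := integrableB measurableT (iG js tT) (iG js tauT).
  by apply: eq_integrable => // y _.
by move=> y; exact: GM.
Qed.

(* By the mean value theorem the difference quotient of [G j] is a value of
   [G j.+1] at a nearby time, so that no dominated convergence is needed. *)
Let tquot_A j t : (j < s)%N -> t \in `[0, T] ->
  tquot (A j) t @ within `[0, T]%classic t^' --> A j.+1 t.
Proof.
move=> js tT; have js' := ltnW js.
apply/cvgrPdist_le => e e0; have [d' d0 dC] := powR_small mu0 I0 e0.
rewrite near_withinE; near=> tau => tauT.
have ttau : t != tau by rewrite eq_sym; near: tau; exact: nbhs_dnbhs_neq.
rewrite distrC.
have itq : nu.-integrable setT (EFin \o (fun y => tquot (fun u => G j u y) t tau)).
  have := integrableZr measurableT (tau - t)^-1
    (integrableB measurableT (iG js' tauT) (iG js' tT)).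
  by apply: eq_integrable => // y _.
have -> : tquot (A j) t tau = Rintegral nu setT (fun y => tquot (fun u => G j u y) t tau).
  rewrite /tquot RintegralZr //; first by rewrite RintegralB ?iG.
  have := integrableB measurableT (iG js' tauT) (iG js' tT).
  by apply: eq_integrable => // y _.
rewrite -RintegralB ?iG //.
apply: le_trans (_ : I * `|tau - t| `^ mu <= e); last first.
  apply: dC; rewrite normr_ge0 /= distrC.
  near: tau; apply: nbhs_dnbhs; apply/nbhs_ballP; exists d' => //= u.
  by rewrite /ball /= => /ltW.
apply: le_Rintegral_M.
  have := integrableB measurableT itq (iG js tT).
  by apply: eq_integrable => // y _.
move=> y /=.
have cG : {within `[0, T], continuous (fun u => G j u y)}.
  by apply: (hoelder_continuous_within mu0 (M0 y)) => u v uT vT; exact: GM.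
have [xi xiT [-> xit]] := tquot_mvt tT tauT ttau cG (fun u => @dG j u y js).
apply: le_trans (GM _ _ _ _) _ => //.
by rewrite ler_wpM2l // ge0_ler_powR // ?nnegrE // ltW.
Unshelve. all: by end_near. Qed.

Let iter_tderiv_A j t : (j <= s)%N -> t \in `[0, T] -> iter j (tderiv T) (A 0) t = A j t.
Proof.
elim: j t => // j IHj t js tT; rewrite iterS.
have [|//] := tderiv_cvg tT (l := A j.+1 t) (a := iter j (tderiv T) (A 0)).
by apply: (@eq_tquot_cvg _ (A j)) => // [tau|]; [apply: IHj; exact: ltnW|exact: tquot_A].
Qed.

Lemma inC_time_Rintegral : inC_time T s mu (fun t => Rintegral nu setT (G 0 t)).
Proof.
split=> [j t js tT|j js|j js].
- have [|//] := tderiv_cvg tT (l := A j.+1 t) (a := iter j (tderiv T) (A 0)).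
  apply: (@eq_tquot_cvg _ (A j)) => // [tau|]; last exact: tquot_A.
  by apply: iter_tderiv_A; exact: ltnW.
- apply: (hoelder_continuous_within mu0 I0) => t tau tT tauT.
  by rewrite !iter_tderiv_A // hoelder_A.
- exists I => t tau tT tauT.
  by rewrite !iter_tderiv_A // hoelder_A.
Qed.

End Integral.
End TimeDerivative.

(** * Weighted spaces *)

Section Spaces.
Context {R : realType} {n : nat}.
Variables (U : set 'rV[R]_n) (T : R).
Hypotheses (T0 : 0 < T) (n0 : (0 < n)%N) (Ub : bounded_set U).
Implicit Types (u : R -> 'rV[R]_n -> R) (t tau : R) (x : 'rV[R]_n).

Lemma normC0_ge0 (dl : R) (g : 'rV[R]_n -> R) : (0 <= normC0 dl g)%E.
Proof.
apply: (@le_trans _ _ (weight 0 `^ dl * `|g 0|)%:E).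
  by rewrite lee_fin mulr_ge0 ?powR_ge0.
by apply: ereal_sup_ubound; exists 0.
Qed.

Lemma le_normC0 (dl : R) (g : 'rV[R]_n -> R) x :
  ((weight x `^ dl * `|g x|)%:E <= normC0 dl g)%E.
Proof. by apply: ereal_sup_ubound; exists x. Qed.

Lemma enorm_delta (c : R) (i : 'I_n) : enorm (c *: basis_vec i) = `|c|.
Proof.
rewrite /enorm (bigD1 i) //= big1 => [|j ji]; last first.
  by rewrite !mxE (negbTE ji) andbF mulr0 expr0n.
by rewrite !mxE !eqxx mulr1 addr0 sqrtr_sqr.
Qed.

(* The set over which the supremum is taken is not empty, as [U] is bounded: the
   supremum is not [-oo]. *)
Lemma hoelder_semi_ge0 (lam dl : R) (g : 'rV[R]_n -> R) : (0 <= hoelder_semi U lam dl g)%E.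
Proof.
have [M [_ UM]] := Ub.
pose r : R := Num.max M 0 + 1.
have r0 : 0 < r by rewrite ltr_wpDl // le_max lexx orbT.
have rM : M < r by rewrite (le_lt_trans (_ : _ <= Num.max M 0)) ?le_max ?lexx // ltrDl.
pose e : 'rV[R]_n := basis_vec (Ordinal n0).
have far (c : R) : r < c -> ~ U (c *: e).
  move=> rc /(UM _ rM) /=; apply/negP; rewrite -ltNge (lt_le_trans rc) //.
  apply: (@le_trans _ _ `|(c *: e) 0 (Ordinal n0)|).
    by rewrite !mxE !eqxx mulr1 ler_norm.
  rewrite /Num.norm /= mx_normrE.
  exact: (@le_bigmax _ _ _ 0 (fun ij => `|(c *: e) ij.1 ij.2|) (0, Ordinal n0)).
(* Both points lie beyond the bound of [U], and their distance [r] is at most half the norm [4 r] of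
   the first, as the seminorm demands. *)
have Ux : ~ U ((4 * r) *: e) by apply: far; lra.
have Uy : ~ U ((3 * r) *: e) by apply: far; lra.
have d : enorm ((4 * r) *: e - (3 * r) *: e) = r.
  by rewrite -scalerBl enorm_delta gtr0_norm; [ring|lra].
apply: le_trans; last first.
  apply: ereal_sup_ubound; exists ((4 * r) *: e), ((3 * r) *: e); split=> //.
  - by rewrite -subr_eq0 -enorm_eq0 d gt_eqF.
  - by rewrite d enorm_delta gtr0_norm; lra.
by rewrite lee_fin !mulr_ge0 ?invr_ge0 ?powR_ge0.
Qed.

(** A finite sum bounds its terms only once all are known to be nonnegative: an empty supremum is
    [-oo] and would absorb an infinite term. *)
Lemma normC_bounds (lam mu dl : R) u : (normC U T lam mu dl u < +oo)%E ->
  exists2 C : R, 0 <= C &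
    (forall t x, t \in `[0, T] -> `|u t x| <= C * weight x `^ (- dl)) /\
    (forall t tau x, t \in `[0, T] -> tau \in `[0, T] ->
       `|u t x - u tau x| <= C * weight x `^ (- dl) * `|t - tau| `^ mu).
Proof.
rewrite /normC; set a := ereal_sup _; set b := ereal_sup _; set c := ereal_sup _.
have T00 : 0 \in `[0, T] by rewrite in_itv /= lexx ltW.
have TT : T \in `[0, T] by rewrite in_itv /= lexx ltW.
have a0 : (0 <= a)%E.
  apply: le_trans (normC0_ge0 dl (u 0)) _.
  by apply: ereal_sup_ubound; exists 0.
have b0 : (0 <= b)%E.
  apply: le_trans (hoelder_semi_ge0 lam dl (u 0)) _.
  by apply: ereal_sup_ubound; exists 0.
have c0 : (0 <= c)%E.
  apply: (@le_trans _ _ (normC0 dl (fun x => (u 0%R x - u T x)%R) * ((`|0 - T| `^ mu)^-1)%R%:E)%E).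
    by rewrite mule_ge0 ?normC0_ge0 // lee_fin invr_ge0 powR_ge0.
  by apply: ereal_sup_ubound; exists 0, T; split=> //; rewrite lt_eqF.
move=> abc.
have aoo : (a < +oo)%E.
  by apply: le_lt_trans abc; rewrite -addeA leeDl // adde_ge0.
have coo : (c < +oo)%E.
  by apply: le_lt_trans abc; rewrite leeDr // adde_ge0.
have aE : a = (fine a)%:E by rewrite fineK // ge0_fin_numE.
have cE : c = (fine c)%:E by rewrite fineK // ge0_fin_numE.
have fa0 : 0 <= fine a by exact: fine_ge0.
have fc0 : 0 <= fine c by exact: fine_ge0.
have wp x : 0 < weight x `^ dl by rewrite powR_gt0 // weight_gt0.
exists (fine a + fine c); first exact: addr_ge0.
split=> [t x tT|t tau x tT tauT].
  rewrite powRN ler_pdivlMr // mulrC (@le_trans _ _ (fine a)) ?lerDl //.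
  rewrite -lee_fin -aE; apply: le_trans (le_normC0 dl (u t) x) _.
  by apply: ereal_sup_ubound; exists t.
have [->|ttau] := eqVneq t tau.
  by rewrite subrr normr0 !mulr_ge0 ?powR_ge0 ?addr_ge0.
have dp : 0 < `|t - tau| `^ mu by rewrite powR_gt0 // normr_gt0 subr_eq0.
rewrite powRN mulrAC ler_pdivlMr // mulrC -ler_pdivrMr //.
rewrite (@le_trans _ _ (fine c)) ?lerDr //.
rewrite -lee_fin -cE EFinM.
apply: (@le_trans _ _ (normC0 dl (fun x => (u t x - u tau x)%R) * ((`|t - tau| `^ mu)^-1)%R%:E)%E).
  by rewrite lee_wpmul2r ?lee_fin ?invr_ge0 ?powR_ge0 // (le_normC0 dl (fun x => u t x - u tau x)).
by apply: ereal_sup_ubound; exists t, tau.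
Qed.

Lemma mdegree0 : mdegree (fun _ : 'I_n => 0%N) = 0%N.
Proof. by rewrite /mdegree big1. Qed.

Lemma mpderiv0 (g : 'rV[R]_n -> R) : mpderiv (fun=> 0%N) g = g.
Proof. by rewrite /mpderiv; elim: (enum _) => //= i s ->. Qed.

Lemma continuous_cyl_slice u t : continuous_cyl T u -> t \in `[0, T] -> continuous (u t).
Proof.
move=> cu tT x.
have tT' : 0 <= t <= T by move: tT; rewrite in_itv.
have cux := proj1 (subspace_continuousP _ _) cu (t, x) tT'.
have tx : (t, y) @[y --> x] --> (t, x).
  move=> A tA; exact: (cvg_pair (F := nbhs x) (G := nbhs t) (H := nbhs x)
    (f := fun=> t) (g := id) (cvg_cst t) cvg_id tA).
move=> A /cux /tx tA.
have tA' : \forall y \near x, 0 <= t <= T -> A (u t y) := tA.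
suff : \forall y \near x, A (u t y) by [].
by near=> y; apply: (near tA').
Unshelve. all: by end_near. Qed.

(** At the zero multi-indices the condition [|al| + 2j <= 2s] reads [j <= s], and the weight of
    every time derivative is still [dl]. One constant serves all [j], as there are finitely many. *)
Lemma inC2sk_time_derivatives (s k : nat) (lam mu dl : R) u :
  inC2sk U T s k lam mu dl u ->
  let v j t x := iter j (tderiv T) (fun tau => u tau x) t in
  [/\ forall j t, (j <= s)%N -> t \in `[0, T] -> continuous (v j t),
      forall j t x, (j < s)%N -> t \in `[0, T] ->
        tquot (fun tau => v j tau x) t @ within `[0, T]%classic t^' --> v j.+1 t x
    & exists2 C : R, 0 <= C & forall j, (j <= s)%N ->
        (forall t x, t \in `[0, T] -> `|v j t x| <= C * weight x `^ (- dl)) /\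
        (forall t tau x, t \in `[0, T] -> tau \in `[0, T] ->
          `|v j t x - v j tau x| <= C * weight x `^ (- dl) * `|t - tau| `^ mu)].
Proof.
move=> [_ /(_ (fun=> 0%N))]; rewrite mdegree0 => /(_ (leq0n _)).
have uE : (fun t => mpderiv (fun=> 0%N) (u t)) = u by apply/funext => t; exact: mpderiv0.
rewrite addr0 uE => -[_ dv cv nv] v.
have dtxE j : dtx T j (fun=> 0%N) u = v j.
  apply/funext => t; apply/funext => x; rewrite /dtx /v.
  by under eq_fun do rewrite mpderiv0.
split=> [j t js tT|j t x js tT|].
- apply: continuous_cyl_slice tT; rewrite -dtxE.
  by apply: cv; rewrite mdegree0 leq_mul2l.
- have := dv j (fun=> 0%N) t x; rewrite mdegree0 leq_mul2l /= => /(_ js tT).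
  by rewrite dtxE.
suff /choice[C CP] : forall j : 'I_s.+1, exists C : R, 0 <= C /\
    (forall t x, t \in `[0, T] -> `|v j t x| <= C * weight x `^ (- dl)) /\
    (forall t tau x, t \in `[0, T] -> tau \in `[0, T] ->
      `|v j t x - v j tau x| <= C * weight x `^ (- dl) * `|t - tau| `^ mu).
  exists (\sum_j C j); first by apply: sumr_ge0 => j _; have [] := CP j.
  move=> j js; have [Cj [C1 C2]] := CP (Ordinal (js : (j < s.+1)%N)).
  have le_C : C (Ordinal (js : (j < s.+1)%N)) <= \sum_j C j.
    by rewrite (bigD1 (Ordinal (js : (j < s.+1)%N))) //= lerDl sumr_ge0 // => i _; have [] := CP i.
  split=> [t x tT|t tau x tT tauT].
    by apply: le_trans (C1 t x tT) _; rewrite ler_wpM2r ?powR_ge0.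
  by apply: le_trans (C2 t tau x tT tauT) _; rewrite !ler_wpM2r ?powR_ge0.
move=> j.
have := nv j (fun=> 0%N); rewrite mdegree0 addr0 dtxE leq_mul2l /= => /(_ (ltn_ord j)).
by move=> /normC_bounds[C C0 CP]; exists C.
Qed.

End Spaces.

(** * Derivatives in space *)

Section DirectionalDerivatives.
Context {R : realType} {n : nat}.
Implicit Types (g : 'rV[R]_n -> R) (x y : 'rV[R]_n).

Lemma is_derive_line (i : 'I_n) g (phi : R -> R) y (l : R) :
  (forall h, g (h *: basis_vec i + y) = phi h) -> is_derive (0 : R) (1 : R) phi l ->
  is_derive y (basis_vec i) g l.
Proof.
move=> gphi [dphi phil].
have quotE : (fun h : R => h^-1 *: (phi (h *: 1 + 0) - phi 0)) =
    (fun h : R => h^-1 *: (g (h *: basis_vec i + y) - g y)).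
  apply/funext => h; rewrite gphi -[_ *: 1]/(_ * 1) mulr1 addr0.
  by have := gphi 0; rewrite scale0r add0r => ->.
split; first by rewrite /derivable -quotE.
by rewrite -phil /derive quotE.
Qed.

Let enorm_line_sqr (i : 'I_n) x y h : enorm (x - (h *: basis_vec i + y)) ^+ 2 =
  \sum_(j | j != i) (x 0 j - y 0 j) ^+ 2 + (x 0 i - y 0 i - h) ^+ 2.
Proof.
rewrite enorm_sqr (bigD1 i) //= addrC; congr (_ + _).
  by apply: eq_bigr => j ji; rewrite !mxE (negbTE ji) andbF mulr0 add0r.
by rewrite !mxE !eqxx mulr1; ring.
Qed.

Lemma is_derive_enorm_line (i : 'I_n) x y : y != x ->
  is_derive (0 : R) (1 : R) (fun h => enorm (x - (h *: basis_vec i + y)))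
    (- (x 0 i - y 0 i) / enorm (x - y)).
Proof.
move=> yx; have r0 : 0 < enorm (x - y) by rewrite enorm_gt0 subr_eq0 eq_sym.
pose S := \sum_(j | j != i) (x 0 j - y 0 j) ^+ 2.
pose N (h : R) := S + (x 0 i - y 0 i - h) ^+ 2.
have N0 : N 0 = enorm (x - y) ^+ 2.
  by rewrite /N -enorm_line_sqr scale0r add0r.
have -> : (fun h => enorm (x - (h *: basis_vec i + y))) = Num.sqrt \o N.
  apply/funext => h /=.
  by rewrite /N -enorm_line_sqr sqrtr_sqr ger0_norm // enorm_ge0.
have dc : is_derive (0 : R) (1 : R) (fun h => x 0 i - y 0 i - h) (-1).
  have := is_deriveB (is_derive_cst ((x 0 i - y 0 i) : R^o) (0 : R) 1) (is_derive_id (0 : R) 1).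
  by rewrite sub0r.
have dN : is_derive (0 : R) (1 : R) N (- 2 * (x 0 i - y 0 i)).
  have D := is_deriveD (is_derive_cst (S : R^o) (0 : R) 1) (is_deriveX 2 dc).
  by apply: (is_derive_eq D); rewrite /GRing.scale /= subr0 expr1; ring.
have dS : is_derive (N 0) 1 Num.sqrt (2 * Num.sqrt (N 0))^-1.
  by apply: is_derive1_sqrt; rewrite N0 exprn_gt0.
apply: (is_derive_eq (is_derive1_comp dN dS)).
rewrite N0 sqrtr_sqr gtr0_norm //; field.
by rewrite gt_eqF.
Qed.

Lemma is_derive_expf (f : R -> R) (k : nat) (t df : R) : is_derive t (1 : R) f df ->
  is_derive t (1 : R) (fun u => f u ^+ k) (k%:R * f t ^+ k.-1 * df).
Proof.
move=> d; have -> : (fun u => f u ^+ k) = f ^+ k by rewrite exprfctE.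
exact: is_deriveX.
Qed.

(** The logarithm and the power have gradients of the same shape, so that the estimates of the
    kernel need not distinguish [n = 2] from [n >= 3]. *)
Lemma is_derive_fundsol : (2 <= n)%N -> exists c : R, forall (i : 'I_n) x y, y != x ->
  is_derive y (basis_vec i) (fun z => fundsol (x - z))
    (c * (x 0 i - y 0 i) * enorm (x - y) `^ (- n%:R)).
Proof.
move=> n2; exists (if n == 2%N then - (2 * pi)^-1 else
  (n - 2)%:R / ((2 - n%:R) * @sphere_area R n)) => i x y yx.
have r0 : 0 < enorm (x - y) by rewrite enorm_gt0 subr_eq0 eq_sym.
have rnz : enorm (x - y) != 0 by rewrite gt_eqF.
have dr := is_derive_enorm_line i yx.
have E0 : enorm (x - (0 *: basis_vec i + y)) = enorm (x - y) by rewrite scale0r add0r.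
rewrite powRN powR_mulrn ?enorm_ge0 //.
apply: (is_derive_line (phi := fun h => fundsol (x - (h *: basis_vec i + y)))) => //.
rewrite /fundsol; case: ifP => [/eqP n2'|n2'].
  have dl : is_derive (enorm (x - (0 *: basis_vec i + y))) 1 (@ln R) (enorm (x - y))^-1.
    by rewrite E0; exact: is_derive1_ln.
  have D := is_deriveM (is_derive1_comp dr dl) (is_derive_cst ((2 * pi)^-1 : R^o) (0 : R) 1).
  apply: (is_derive_eq D); rewrite scaler0 add0r /GRing.scale /=.
  have -> : enorm (x - y) ^+ n = enorm (x - y) ^+ 2 by move: (enorm _) => r; rewrite n2'.
  by move: rnz; move: (enorm _) ((2 * pi)^-1) => r K rnz; field.
have n3 : (2 < n)%N by rewrite ltn_neqAle eq_sym n2' n2.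
have nz : enorm (x - (0 *: basis_vec i + y)) ^+ (n - 2) != 0 by rewrite E0 expf_neq0.
have dX : is_derive (0 : R) (1 : R) (fun h => enorm (x - (h *: basis_vec i + y)) ^+ (n - 2)) _ :=
  is_derive_expf (n - 2) dr.
have D := is_deriveM (@is_deriveV _ _ 0 _ 1 nz dX)
  (is_derive_cst (((2 - n%:R) * @sphere_area R n)^-1 : R^o) (0 : R) 1).
apply: (is_derive_eq D); rewrite scaler0 add0r /GRing.scale /= E0.
have -> : (n - 2).-1 = (n - 3)%N by rewrite -subnS.
have [k nE] : exists k, n = k.+3 by exists (n - 3)%N; rewrite -addn3 subnK.
move: rnz; move: (enorm _) (x 0 i - y 0 i) (((2 - n%:R) * sphere_area)^-1) => r a K rnz.
rewrite nE !subSS !subn0 -mulr_natl !exprS; field.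
by rewrite rnz expf_neq0.
Qed.

Lemma measurable_enorm_sub x :
  measurable_fun setT (fun t : n.-tuple (measurableTypeR R) => enorm (x - row_of_tuple t)).
Proof.
have -> : (fun t : n.-tuple (measurableTypeR R) => enorm (x - row_of_tuple t)) =
    fun t => (\sum_(i < n) (x 0 i - tnth t i) ^+ 2) `^ 2^-1.
  apply/funext => t; rewrite powR12_sqrt ?sumr_ge0 // => [|i _]; last exact: sqr_ge0.
  by congr Num.sqrt; apply: eq_bigr => i _; rewrite !mxE.
apply: (measurableT_comp (measurable_powR _)).
apply: measurable_sum => i; apply: measurable_funX; apply: measurable_funB => //.
exact: measurable_tnth.
Qed.

Lemma measurable_row_eq x : measurable_fun setT
  (fun t : n.-tuple (measurableTypeR R) => row_of_tuple t == x).
Proof.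
have -> : (fun t : n.-tuple (measurableTypeR R) => row_of_tuple t == x) =
    fun t => enorm (x - row_of_tuple t) == 0.
  by apply/funext => t; rewrite enorm_eq0 subr_eq0 eq_sym.
by apply: measurable_fun_eqr => //; exact: measurable_enorm_sub.
Qed.

End DirectionalDerivatives.

(** * Polynomials: derivatives, measurability and growth *)

Section Polynomials.
Import (canonicals,coercions) mpoly.
Context {R : realType} {n : nat}.
Implicit Types p q : mpoly.mpoly n R.

(** The polynomials whose formal derivative is the analytic one contain the constants and the
    variables, and are closed under sums and products. *)
Lemma is_derive_peval (i : 'I_n) p (y : 'rV[R]_n) :
  is_derive y (basis_vec i) (peval p) (peval (mpoly.mderiv i p) y).
Proof.
pose Q p := forall y, is_derive y (basis_vec i) (peval p) (peval (mpoly.mderiv i p) y).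
suff : Q p by apply.
have QD p1 p2 : Q p1 -> Q p2 -> Q (p1 + p2).
  move=> Q1 Q2 z; have D := is_deriveD (Q1 z) (Q2 z).
  rewrite mpoly.mderivD /peval mpoly.mevalD.
  by rewrite (_ : (fun x => _) = peval p1 + peval p2) //; apply/funext => x; rewrite mpoly.mevalD.
have QM p1 p2 : Q p1 -> Q p2 -> Q (p1 * p2).
  move=> Q1 Q2 z; have D := is_deriveM (Q1 z) (Q2 z).
  have -> : peval (p1 * p2) = peval p1 * peval p2.
    by apply/funext => x; rewrite /peval mpoly.mevalM.
  apply: (is_derive_eq D).
  by rewrite mpoly.mderivM /peval mpoly.mevalD !mpoly.mevalM /GRing.scale /=; ring.
have QC (c : R) : Q (mpoly.mpolyC n c).
  move=> z; rewrite mpoly.mderivC /peval mpoly.meval0.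
  by under eq_fun do rewrite mpoly.mevalC; exact: is_derive_cst.
have QX j : Q (mpoly.mpolyX R (mpoly.mnm1 j)).
  move=> z; apply: (is_derive_line (phi := fun h => h * (j == i)%:R + z 0 j)).
    by move=> h; rewrite /peval mpoly.mevalXU !mxE eqxx /=.
  have D := is_deriveD (is_deriveM (is_derive_id (0 : R) 1)
    (is_derive_cst ((j == i)%:R : R^o) (0 : R) 1)) (is_derive_cst (z 0 j : R^o) (0 : R) 1).
  apply: (is_derive_eq D); rewrite scaler0 add0r addr0 /GRing.scale /= mulr1.
  rewrite /peval mpoly.mderivX mpoly.mevalZ mpoly.mnm1E.
  case: eqP => [->|]; last by rewrite mul0r.
  have -> : mpoly.mnm_sub (mpoly.mnm1 i) (mpoly.mnm1 i) = mpoly.mnm0.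
    by apply/mpoly.mnmP => l; rewrite mpoly.mnmBE mpoly.mnm0E subnn.
  by rewrite mpoly.mpolyX0 mpoly.meval1 mulr1.
rewrite (mpoly.mpolyE p); apply: (big_ind Q) => [||m _].
- by have := QC 0; rewrite mpoly.mpolyC0.
- exact: QD.
rewrite -mpoly.mul_mpolyC; apply: (QM _ _ (QC _)).
rewrite mpoly.mpolyXE_id; apply: (big_ind Q) => [||j _].
- by have := QC 1; rewrite mpoly.mpolyC1.
- exact: QM.
elim: (mpoly.fun_of_multinom m j) => [|k IH].
  by rewrite expr0; have := QC 1; rewrite mpoly.mpolyC1.
by rewrite exprS; apply: (QM _ _ (QX j)).
Qed.

Lemma measurable_peval p : measurable_fun setT (peval p \o @row_of_tuple R n).
Proof.
have -> : peval p \o @row_of_tuple R n = fun t => \sum_(m <- mpoly.msupp p)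
    (mpoly.mcoeff m p * \prod_(i < n) tnth t i ^+ mpoly.fun_of_multinom m i).
  apply/funext => t /=; rewrite /peval mpoly.mevalE; apply: eq_bigr => m _.
  by congr (_ * _); apply: eq_bigr => i _; rewrite mxE.
apply: measurable_sum => m; apply: measurable_funM; first exact: measurable_cst.
by apply: measurable_prod => i _; apply: measurable_funX; exact: measurable_tnth.
Qed.

Lemma peval_bound p (d : nat) : all (fun m => (mpoly.mdeg m <= d)%N) (mpoly.msupp p) ->
  exists2 C : R, 0 <= C & forall x : 'rV[R]_n, `|peval p x| <= C * weight x ^+ d.
Proof.
move=> pd; exists (\sum_(m <- mpoly.msupp p) `|mpoly.mcoeff m p|).
  exact: sumr_ge0.
move=> x; rewrite /peval mpoly.mevalE mulr_suml.
apply: le_trans (ler_norm_sum _ _ _) _;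
rewrite [leLHS]big_seq [leRHS]big_seq.
apply: ler_sum => m /(allP pd) md; rewrite normrM ler_wpM2l // normr_prod.
apply: (@le_trans _ _ (\prod_(i < n) weight x ^+ mpoly.fun_of_multinom m i)).
  apply: ler_prod => i _; rewrite normr_ge0 normrX /= lerXn2r ?nnegrE ?weight_ge0 //.
  by apply: le_trans (enorm_le_weight x); exact: ler_norm_enorm.
by rewrite prodrXr -mpoly.mdegE ler_weXn2l // weight_ge1.
Qed.

Lemma mderiv_homog (i : 'I_n) (l : nat) p : harmonic_homog l p ->
  all (fun m => (mpoly.mdeg m <= l.-1)%N) (mpoly.msupp (mpoly.mderiv i p)).
Proof.
move=> [/allP hp _]; apply/allP => m; rewrite mpoly.mcoeff_msupp mpoly.mcoeff_mderiv => mp.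
have /hp : mpoly.mnm_add m (mpoly.mnm1 i) \in mpoly.msupp p.
  by rewrite mpoly.mcoeff_msupp; apply: contra mp => /eqP ->; rewrite mul0rn.
by rewrite /= mpoly.mdegD mpoly.mdeg1 addn1 => /eqP <-.
Qed.

End Polynomials.

(** * Kernels *)

Section TameKernels.
Context {R : realType} {n : nat}.
Implicit Types (x y : 'rV[R]_n) (k v : 'rV[R]_n -> R).
Notation row := (@row_of_tuple R n).

Lemma enormN x : enorm (- x) = enorm x.
Proof. by congr Num.sqrt; apply: eq_bigr => i _; rewrite mxE sqrrN. Qed.

Lemma measurable_weight : measurable_fun setT (fun t => weight (row t)).
Proof.
have -> : (fun t => weight (row t)) = fun t => (1 + enorm (0 - row t) ^+ 2) `^ 2^-1.
  by apply/funext => t; rewrite powR12_sqrt ?addr_ge0 ?sqr_ge0 // sub0r enormN.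
apply: (measurableT_comp (measurable_powR _)).
apply: measurable_funD => //; apply: measurable_funX.
exact: measurable_enorm_sub.
Qed.

Definition growth (m : nat) x y : R :=
  weight y ^+ m * Num.max 1 (enorm (x - y) `^ (1 - n%:R)).

(* Kernels with at most polynomial growth of degree [m] at infinity and a singularity
   at [x] of the type of a first derivative of the fundamental solution. *)
Definition tame (m : nat) x k : Prop :=
  measurable_fun setT (k \o row) /\ exists2 C : R, 0 <= C &
    forall y, y != x -> `|k y| <= C * growth m x y.

(** At [y = x] the kernel is a derivative at a singular point, with a value about which nothing is
    known; changing one value preserves measurability. *)
Lemma tame_ext m x k k' : (forall y, y != x -> k y = k' y) -> tame m x k' -> tame m x k.
Proof.
move=> kk' [mk' [C C0 kC]]; split; last by exists C => // y yx; rewrite kk' // kC.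
have -> : k \o row = fun t => if row t == x then k x else (k' \o row) t.
  by apply/funext => t /=; case: eqVneq => [->//|tx]; rewrite kk'.
by apply: measurable_fun_ifT => //; exact: measurable_row_eq.
Qed.

Lemma tameZ m x (c : R) k : tame m x k -> tame m x (fun y => c * k y).
Proof.
move=> [mk [C C0 kC]]; split; first exact: measurable_funM.
exists (`|c| * C); first exact: mulr_ge0.
by move=> y yx; rewrite normrM -mulrA ler_wpM2l // kC.
Qed.

Lemma tame_sum m x (I : finType) (P : pred I) (k : I -> 'rV[R]_n -> R) :
  (forall i, tame m x (k i)) -> tame m x (fun y => \sum_(i | P i) k i y).
Proof.
move=> tk; split.
  have -> : (fun y => \sum_(i | P i) k i y) \o row =
      fun t => \sum_(i <- seq.filter P (index_enum I)) (k i \o row) t.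
    by apply/funext => t /=; rewrite big_filter.
  by apply: measurable_sum => i; have [] := tk i.
have /choice[C CP] : forall i, exists C : R, 0 <= C /\
    forall y, y != x -> `|k i y| <= C * growth m x y.
  by move=> i; have [_ [C C0 kC]] := tk i; exists C.
exists (\sum_(i | P i) C i); first by apply: sumr_ge0 => i _; have [] := CP i.
move=> y yx; rewrite mulr_suml; apply: le_trans (ler_norm_sum _ _ _) _.
by apply: ler_sum => i _; have [_] := CP i; apply.
Qed.

(** The coordinate factor is at most [|x - y|] and lowers the order of the singularity from [n] to
    [n - 1]. *)
Lemma tame_riesz m x (i : 'I_n) :
  tame m x (fun y => (x 0 i - y 0 i) * enorm (x - y) `^ (- n%:R)).
Proof.
split.
  apply: measurable_funM; last first.
    exact: (measurableT_comp (measurable_powR _) (measurable_enorm_sub x)).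
  apply: measurable_funB => //.
  rewrite (_ : (fun t => row t 0 i) = (fun t => tnth t i)); first exact: measurable_tnth.
  by apply/funext => t; rewrite mxE.
exists 1 => // y yx; have r0 : 0 < enorm (x - y) by rewrite enorm_gt0 subr_eq0 eq_sym.
rewrite mul1r -[leLHS]mul1r; apply: ler_pM => //.
  by rewrite exprn_ege1 // weight_ge1.
rewrite le_max; apply/orP; right.
rewrite normrM (ger0_norm (powR_ge0 _ _)) powRD; last by rewrite (gt_eqF r0) implybT.
rewrite powRr1 ?enorm_ge0 // ler_wpM2r ?powR_ge0 //.
by have := ler_norm_enorm (x - y) i; rewrite !mxE.
Qed.

Lemma tame_ker_phi m x (I L : {set 'I_n}) : (2 <= n)%N ->
  tame m x (fun y => ker_phi x I y L).
Proof.
move=> n2; have [c dc] := @is_derive_fundsol R n n2.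
pose w := hodge (dxI I) : multivec R n.
apply: (@tame_ext _ _ _ (fun y => \sum_(i | i \notin L)
    (- (wsign [set i]%SET L * w (i |: L)%SET * c)) *
    ((x 0 i - y 0 i) * enorm (x - y) `^ (- n%:R)))).
  move=> y yx; rewrite /ker_phi /codiff ffunE -sumrN; apply: eq_bigr => i _.
  have D := is_deriveM (dc i x y yx) (is_derive_cst (w (i |: L)%SET : R^o) y (basis_vec i)).
  rewrite /pderiv (_ : (fun z => _) =
    (fun z => fundsol (x - z)) * cst (w (i |: L)%SET)); last first.
    by apply/funext => z; rewrite ffunE.
  by rewrite (derive_val (is_derive := D)) scaler0 add0r /GRing.scale /=; ring.
by apply: tame_sum => i; apply: tameZ; exact: tame_riesz.
Qed.

Import (canonicals,coercions) mpoly.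

Lemma tame_peval m x (p : mpoly.mpoly n R) (d : nat) : (d <= m)%N ->
  all (fun a => (mpoly.mdeg a <= d)%N) (mpoly.msupp p) -> tame m x (peval p).
Proof.
move=> dm pd; split; first exact: measurable_peval.
have [C C0 pC] := peval_bound pd; exists C => // y _.
apply: le_trans (pC y) _; rewrite ler_wpM2l // -[leLHS]mulr1; apply: ler_pM => //.
- by rewrite exprn_ge0 // weight_ge0.
- by rewrite ler_weXn2l // weight_ge1.
- by rewrite le_max lexx.
Qed.

(** The codifferential lowers the degree by one: the range [l <= m + 1] of the correction terms
    yields growth of degree at most [m]. *)
Lemma tame_codiff_harmonic m x l (p : mpoly.mpoly n R) (I L : {set 'I_n}) :
  (l <= m.+1)%N -> harmonic_homog l p ->
  tame m x (fun y => codiff (fun z => peval p z *: hodge (dxI I)) y L).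
Proof.
move=> lm hp; pose w := hodge (dxI I) : multivec R n.
apply: (@tame_ext _ _ _ (fun y => \sum_(i | i \notin L)
    (- (wsign [set i]%SET L * w (i |: L)%SET)) * peval (mpoly.mderiv i p) y)).
  move=> y _; rewrite /codiff ffunE -sumrN; apply: eq_bigr => i _.
  have D := is_deriveM (is_derive_peval i p y)
    (is_derive_cst (w (i |: L)%SET : R^o) y (basis_vec i)).
  rewrite /pderiv (_ : (fun z => _) = peval p * cst (w (i |: L)%SET)); last first.
    by apply/funext => z; rewrite ffunE.
  by rewrite (derive_val (is_derive := D)) scaler0 add0r /GRing.scale /=; ring.
apply: tame_sum => i; apply: tameZ; apply: (@tame_peval _ _ _ l.-1).
  by rewrite -ltnS (leq_trans (leqSpred _) _) //; case: l lm {hp}.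
exact: mderiv_homog.
Qed.

Lemma integrable_mul_tame m x (dl C : R) v k : (0 < n)%N -> n%:R + m%:R < dl ->
  measurable_fun setT (v \o row) -> 0 <= C ->
  (forall y, `|v y| <= C * weight y `^ (- dl)) -> tame m x k ->
  (lebesgue_tuple n).-integrable setT (EFin \o ((fun y => v y * k y) \o row)).
Proof.
move=> n0 ndl mv C0 vC [mk [D D0 kD]].
have p0 : 0 <= dl - m%:R by rewrite subr_ge0 (le_trans _ (ltW ndl)) // lerDr.
(* The growth of the kernel costs [m] orders of decay; the last factor is the price of moving the
   weight from [y] to [x - y]. *)
apply: (@integrable_sing_weight _ _ (dl - m%:R) (C * D * (2 * weight x) `^ (dl - m%:R)) x) => //.
- by rewrite ltrBrDr.
- by rewrite !mulr_ge0 ?powR_ge0.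
- exact: measurable_funM.
move=> y yx; rewrite normrM.
apply: le_trans (ler_pM (normr_ge0 _) (normr_ge0 _) (vC y) (kD y yx)) _.
have -> : C * weight y `^ (- dl) *
    (D * (weight y ^+ m * Num.max 1 (enorm (x - y) `^ (1 - n%:R)))) =
    C * D * (weight y `^ (- (dl - m%:R)) * Num.max 1 (enorm (x - y) `^ (1 - n%:R))).
  rewrite opprB (@powRD _ (weight y)); last by rewrite (gt_eqF (weight_gt0 y)) implybT.
  rewrite powR_mulrn ?weight_ge0 //.
  ring.
rewrite /sing_weight -!mulrA !ler_wpM2l // mulrA ler_wpM2r ?le_max ?ler01 //.
exact: weight_sub_powRN.
Qed.

End TameKernels.

(** * Moments of forms *)

Lemma Rintegral_sum d (Y : measurableType d) (R : realType) (nu : {measure set Y -> \bar R})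
    (I : eqType) (r : seq I) (P : pred I) (g : I -> Y -> R) :
  (forall i, i \in r -> P i -> nu.-integrable setT (EFin \o g i)) ->
  nu.-integrable setT (EFin \o (fun y => \sum_(i <- r | P i) g i y)) /\
  Rintegral nu setT (fun y => \sum_(i <- r | P i) g i y) =
    \sum_(i <- r | P i) Rintegral nu setT (g i).
Proof.
elim: r => [|i r IH] ig.
  rewrite big_nil; under eq_fun do rewrite big_nil; split; last by rewrite Rintegral_cst // mul0r.
  exact: integrable0.
have [ir Er] : nu.-integrable setT (EFin \o (fun y => \sum_(i <- r | P i) g i y)) /\
  Rintegral nu setT (fun y => \sum_(i <- r | P i) g i y) =
    \sum_(i <- r | P i) Rintegral nu setT (g i).
  by apply: IH => j jr; apply: ig; rewrite inE jr orbT.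
case Pi : (P i); last first.
  have -> : (fun y => \sum_(j <- i :: r | P j) g j y) = (fun y => \sum_(j <- r | P j) g j y).
    by apply/funext => y; rewrite big_cons Pi.
  by rewrite big_cons Pi.
have ii := ig i (mem_head _ _) Pi.
have -> : (fun y => \sum_(j <- i :: r | P j) g j y) =
    (fun y => g i y + \sum_(j <- r | P j) g j y).
  by apply/funext => y; rewrite big_cons Pi.
rewrite big_cons Pi -Er RintegralD //; split=> //.
have := integrableD measurableT ii ir.
by apply: eq_integrable => // y _.
Qed.

Lemma wedge_mv_setT (R : realType) (n : nat) (a b : multivec R n) :
  wedge_mv a b [set: 'I_n]%SET =
  \sum_(K : {set 'I_n}) wsign K (~: K)%SET * a K * b (~: K)%SET.
Proof.
rewrite ffunE; apply: eq_big => K; first by rewrite finset.subsetT.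
by rewrite finset.setTD.
Qed.

Section Moments.
Context {R : realType} {n : nat}.
Variables (U : set 'rV[R]_n) (T : R) (s k : nat) (lam mu dl : R) (q m : nat).
Variables (f : R -> diff_form R n).
Hypotheses (T0 : 0 < T) (n0 : (0 < n)%N) (Ub : bounded_set U) (mu0 : 0 < mu).
Hypothesis dln : n%:R + m%:R < dl.
Hypothesis fC : inCform U T s k lam mu dl q f.
Notation row := (@row_of_tuple R n).

Let v (K : {set 'I_n}) j t x : R := iter j (tderiv T) (fun tau => f tau x K) t.

(** The coefficients [c] absorb the signs of the wedge product and constant factors. The sum is
    restricted to the degree of [f], where the regularity in time is available. *)
Definition moment_density (c : {set 'I_n} -> R) (g : diff_form R n) t y : R :=
  \sum_(K : {set 'I_n} | #|K| == q) c K * f t y K * g y (~: K)%SET.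

Let density c (g : diff_form R n) j t y : R :=
  \sum_(K : {set 'I_n} | #|K| == q) c K * v K j t y * g y (~: K)%SET.

Section Density.
Variables (c : {set 'I_n} -> R) (g : diff_form R n) (x : 'rV[R]_n).
Hypothesis tg : forall L, tame m x (fun y => g y L).

Let integrable_density j t : (j <= s)%N -> t \in `[0, T] ->
  (lebesgue_tuple n).-integrable setT (EFin \o (density c g j t \o row)).
Proof.
move=> js tT.
have H := @Rintegral_sum _ _ _ (lebesgue_tuple n) _ (index_enum {set 'I_n}) (fun K => #|K| == q)
  (fun K t' => c K * v K j t (row t') * g (row t') (~: K)%SET).
apply: (proj1 (H _)) => K _ /eqP Kq.
have [cv _ [C C0 CP]] := inC2sk_time_derivatives T0 n0 Ub (fC.1 K Kq).
have := integrable_mul_tame (v := fun y => c K * v K j t y) (C := `|c K| * C)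
  n0 dln _ _ _ (tg (~: K)%SET).
apply.
- apply: measurable_funM => //.
  by apply: continuous_measurable_row; exact: cv.
- exact: mulr_ge0.
- move=> y; rewrite normrM -mulrA ler_wpM2l //.
  by have [+ _] := CP j js; apply.
Qed.

Lemma integrable_moment t : t \in `[0, T] ->
  (lebesgue_tuple n).-integrable setT (EFin \o (moment_density c g t \o row)).
Proof. exact: (@integrable_density 0). Qed.

Lemma inC_time_moment : inC_time T s mu
  (fun t => Rintegral (lebesgue_tuple n) setT (moment_density c g t \o row)).
Proof.
(* Choice wants a constant for every [K]; those of the wrong cardinality receive 0. *)
have /choice[C CP] : forall K : {set 'I_n}, exists C : R, 0 <= C /\ (#|K| = q ->
    forall j, (j <= s)%N -> forall t tau y, t \in `[0, T] -> tau \in `[0, T] ->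
      `|v K j t y - v K j tau y| <= C * weight y `^ (- dl) * `|t - tau| `^ mu).
  move=> K; have [Kq|Kq] := eqVneq #|K| q; last by exists 0; split=> // /eqP; rewrite (negbTE Kq).
  have [_ _ [C C0 CP]] := inC2sk_time_derivatives T0 n0 Ub (fC.1 K Kq).
  by exists C; split=> // _ j js; have [_] := CP j js.
(* A Hoelder constant in time at the point [y], common to all derivatives of order at most [s]. It
   is integrable because the absolute value of a tame kernel is tame. *)
pose M (y : 'rV[R]_n) : R := \sum_(K : {set 'I_n} | #|K| == q)
  `|c K| * C K * weight y `^ (- dl) * `|g y (~: K)%SET|.
have C0 K : 0 <= C K by have [] := CP K.
apply: (inC_time_Rintegral T0 (G := fun j t => density c g j t \o row) (M := M \o row)) => //.
- move=> y; apply: sumr_ge0 => K _.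
  by rewrite !mulr_ge0 ?powR_ge0.
- have H := @Rintegral_sum _ _ _ (lebesgue_tuple n) _ (index_enum {set 'I_n}) (fun K => #|K| == q)
    (fun K t' => `|c K| * C K * weight (row t') `^ (- dl) * `|g (row t') (~: K)%SET|).
  apply: (proj1 (H _)) => K _ _.
  have tg' : tame m x (fun y => `|g y (~: K)%SET|).
    have [mg [D D0 gD]] := tg (~: K)%SET; split; first exact: measurableT_comp.
    by exists D => // y yx; rewrite normr_id; exact: gD.
  have := integrable_mul_tame (v := fun y => `|c K| * C K * weight y `^ (- dl))
    (C := `|c K| * C K) n0 dln _ _ _ tg'.
  apply.
  + apply: measurable_funM; first exact: measurable_cst.
    exact: (measurableT_comp (measurable_powR _) measurable_weight).
  + exact: mulr_ge0.
  + by move=> y; rewrite ger0_norm // !mulr_ge0 ?powR_ge0.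
- move=> j t tau t' js tT tauT /=; set y := row t'.
  rewrite /density /M -sumrB mulr_suml; apply: le_trans (ler_norm_sum _ _ _) _.
  apply: ler_sum => K /eqP Kq.
  have -> : c K * v K j t y * g y (~: K)%SET - c K * v K j tau y * g y (~: K)%SET =
      c K * (v K j t y - v K j tau y) * g y (~: K)%SET by ring.
  rewrite !normrM.
  have := (CP K).2 Kq j js t tau y tT tauT.
  move=> /(ler_wpM2l (normr_ge0 (c K))) /(ler_wpM2r (normr_ge0 (g y (~: K)%SET))).
  by move/le_trans; apply; rewrite le_eqVlt; apply/orP; left; apply/eqP; ring.
- move=> j t t' js tT /=; set y := row t'.
  have -> : tquot (fun u => density c g j u y) t = fun tau =>
      \sum_(K : {set 'I_n} | #|K| == q) c K * tquot (fun u => v K j u y) t tau * g y (~: K)%SET.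
    apply/funext => tau; rewrite /tquot /density -sumrB mulr_suml.
    by apply: eq_bigr => K _; ring.
  apply: cvg_big => [|K /eqP Kq]; first exact: add_continuous.
  have [_ dv _] := inC2sk_time_derivatives T0 n0 Ub (fC.1 K Kq).
  apply: cvgMl; apply: cvgMr; exact: dv.
Qed.

End Density.

Lemma wedge_moment_density t y (b : multivec R n) : t \in `[0, T] ->
  wedge_mv (f t y) b [set: 'I_n]%SET =
  moment_density (fun K => wsign K (~: K)%SET) (fun=> b) t y.
Proof.
move=> tT; rewrite wedge_mv_setT (bigID (fun K : {set 'I_n} => #|K| == q)) /=.
rewrite [X in _ + X]big1 ?addr0 // => K /eqP Kq.
by rewrite fC.2 // mulr0 mul0r.
Qed.

End Moments.

(** * The difference of the two potentials *)

Section Difference.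
Context {R : realType} {n : nat}.
Variables (U : set 'rV[R]_n) (T : R) (s k : nat) (lam mu dl : R) (q m : nat).
Variables (f : R -> diff_form R n).
Variables (J : nat -> nat) (h : forall l, 'I_(J l) -> mpoly.mpoly n R).
Variable theta : 'rV[R]_n -> R.
Hypotheses (T0 : 0 < T) (n2 : (2 <= n)%N) (Ub : bounded_set U) (mu0 : 0 < mu).
Hypothesis dln : n%:R + m%:R < dl.
Hypothesis fC : inCform U T s k lam mu dl q.+1 f.
Hypothesis hh : forall l j, harmonic_homog l (h (l := l) j).
Notation row := (@row_of_tuple R n).

Let n0 : (0 < n)%N. Proof. exact: ltnW. Qed.

Let ker_h (I : {set 'I_n}) l (j : 'I_(J l)) : diff_form R n :=
  codiff (fun z => peval (h j) z *: hodge (dxI I)).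

Let density (c : R) (g : diff_form R n) t : 'rV[R]_n -> R :=
  moment_density q.+1 f (fun K => c * wsign K (~: K)%SET) g t.

Let integral (w : 'rV[R]_n -> R) : R := Rintegral (lebesgue_tuple n) setT (w \o row).

Definition harmonic_moment (I : {set 'I_n}) l (j : 'I_(J l)) (t : R) : R :=
  integral (density (-1) (ker_h I j) t).

Lemma inC_time_harmonic_moment I l (j : 'I_(J l)) : (l <= m.+1)%N ->
  inC_time T s mu (harmonic_moment I j).
Proof.
(* A polynomial kernel is tame at any base point; 0 is an arbitrary choice. *)
move=> lm; apply: (inC_time_moment T0 n0 Ub mu0 dln fC _ (x := 0)) => L.
exact: tame_codiff_harmonic (hh j).
Qed.

Let integrable_tame x (c : R) (g : diff_form R n) t : t \in `[0, T] ->
  (forall L, tame m x (fun y => g y L)) ->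
  (lebesgue_tuple n).-integrable setT (EFin \o (density c g t \o row)).
Proof. by move=> tT tg; apply: (integrable_moment T0 n0 Ub dln fC _ tg). Qed.

Let harmonic_momentE I l (j : 'I_(J l)) t : (l <= m.+1)%N -> t \in `[0, T] ->
  integral (density 1 (ker_h I j) t) = - harmonic_moment I j t.
Proof.
move=> lm tT; rewrite /harmonic_moment /integral -[RHS]mulN1r.
rewrite -RintegralZl //; last first.
  by apply: (@integrable_tame 0) => // L; exact: tame_codiff_harmonic (hh j).
apply: eq_Rintegral => y _ /=; rewrite /density /moment_density mulr_sumr.
by apply: eq_bigr => K _; ring.
Qed.

Lemma form_int_ker_phi_m t x I : t \in `[0, T] ->
  form_int (fun y => wedge_mv (f t y) (ker_phi x I y)) -
  form_int (fun y => wedge_mv (f t y) (ker_phi_m h theta m x I y)) =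
  \sum_(1 <= l < m.+2) \sum_(j < J l) harmonic_moment I j t * ext_harmonic h theta j x.
Proof.
move=> tT.
have formE (g : diff_form R n) :
    form_int (fun y => wedge_mv (f t y) (g y)) = integral (density 1 g t).
  rewrite /form_int /intRn preimage_setT; apply: eq_Rintegral => y _ /=.
  rewrite (wedge_moment_density fC) //; apply: eq_bigr => K _.
  by rewrite mul1r.
have ilj l (j : 'I_(J l)) : (l <= m.+1)%N -> (lebesgue_tuple n).-integrable setT
    (EFin \o (fun t' => ext_harmonic h theta j x * density 1 (ker_h I j) t (row t'))).
  move=> lm; have := @integrable_tame 0 1 (ker_h I j) t tT
    (fun L => tame_codiff_harmonic 0 I L lm (hh j)).
  move=> /(integrableZl measurableT (ext_harmonic h theta j x)).
  by apply: eq_integrable => // y _.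
have sum_l l : (l <= m.+1)%N -> (lebesgue_tuple n).-integrable setT (EFin \o (fun t' =>
      \sum_(j < J l) ext_harmonic h theta j x * density 1 (ker_h I j) t (row t'))) /\
    Rintegral (lebesgue_tuple n) setT (fun t' =>
      \sum_(j < J l) ext_harmonic h theta j x * density 1 (ker_h I j) t (row t')) =
    - \sum_(j < J l) harmonic_moment I j t * ext_harmonic h theta j x.
  move=> lm; have [|il ->] := Rintegral_sum (nu := lebesgue_tuple n)
    (r := index_enum 'I_(J l)) (P := xpredT)
    (g := fun j t' => ext_harmonic h theta j x * density 1 (ker_h I j) t (row t')).
    by move=> j _ _; exact: ilj.
  split=> //; rewrite -sumrN; apply: eq_bigr => j _.
  rewrite RintegralZl //; last first.
    by apply: (@integrable_tame 0) => // L; exact: tame_codiff_harmonic (hh j).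
  by have := harmonic_momentE I j lm tT; rewrite /integral => ->; ring.
have [|iS ES] := Rintegral_sum (nu := lebesgue_tuple n) (r := index_iota 1 m.+2) (P := xpredT)
  (g := fun l t' => \sum_(j < J l) ext_harmonic h theta j x * density 1 (ker_h I j) t (row t')).
  by move=> l; rewrite mem_index_iota => /andP[_ lm] _; have [] := sum_l l lm.
have iphi : (lebesgue_tuple n).-integrable setT (EFin \o (density 1 (ker_phi x I) t \o row)).
  by apply: (@integrable_tame x) => // L; exact: tame_ker_phi.
have -> : form_int (fun y => wedge_mv (f t y) (ker_phi_m h theta m x I y)) =
    integral (density 1 (ker_phi x I) t) + Rintegral (lebesgue_tuple n) setT
      (fun t' => \sum_(1 <= l < m.+2) \sum_(j < J l)
         ext_harmonic h theta j x * density 1 (ker_h I j) t (row t')).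
  rewrite formE -RintegralD //; apply: eq_Rintegral => t' _ /=; set y := row t'.
  (* The sum over [K] is brought outermost, so that the kernels can be compared coefficient by
     coefficient. *)
  under eq_bigr => l _.
    under eq_bigr => j _.
      rewrite /density /moment_density mulr_sumr.
      over.
    rewrite exchange_big /=.
    over.
  rewrite exchange_big /= /density /moment_density -big_split /=.
  apply: eq_bigr => K _.
  rewrite /ker_phi_m ffunE sum_ffunE mulrDr mulr_sumr; congr (_ + _).
  apply: eq_bigr => l _; rewrite sum_ffunE mulr_sumr; apply: eq_bigr => j _.
  by rewrite [X in _ * X]ffunE /GRing.scale /= /ker_h; ring.
rewrite formE opprD addrA subrr add0r ES -sumrN.
rewrite big_nat [RHS]big_nat; apply: eq_bigr => l /andP[_ lm].
by have [_ ->] := sum_l l lm; rewrite opprK.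
Qed.

Lemma potential_sub t x : t \in `[0, T] ->
  potential ker_phi q f t x - potential (ker_phi_m h theta m) q f t x =
  \sum_(I : {set 'I_n} | #|I| == q) \sum_(1 <= l < m.+2) \sum_(j < J l)
    (harmonic_moment I j t * ext_harmonic h theta j x) *: dxI I.
Proof.
move=> tT; rewrite /potential -sumrB; apply: eq_bigr => I _.
rewrite -scalerBl form_int_ker_phi_m // scaler_suml.
by apply: eq_bigr => l _; rewrite scaler_suml.
Qed.

End Difference.

Theorem mainTheorem5 (R : realType) (n s k m q : nat) (lam dl T : R)
    (U : set 'rV[R]_n) (J : nat -> nat)
    (h : forall l : nat, 'I_(J l) -> mpoly.mpoly n R) (theta : 'rV[R]_n -> R)
    (hn : (2 <= n)%N) (hlam : 0 < lam < 1)
    (hdl : n%:R + m%:R - 1 < dl < n%:R + m%:R)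
    (hT : 0 < T) (hq : (q <= n - 1)%N)
    (hU : nbhs (0 : 'rV[R]_n) U) (hUb : bounded_set U)
    (hh : spherical_harmonics h)
    (htheta : smooth theta)
    (htheta2 : forall x, 2 <= enorm x -> theta x = enorm x)
    (htheta1 : forall x, 0 < 1 / theta x <= 1)
    (f : R -> diff_form R n)
    (hf : inZ U T s k lam (dl + 1) q.+1 f) :
  exists a : {set 'I_n} -> forall l : nat, 'I_(J l) -> R -> R,
    (forall (I : {set 'I_n}) (l : nat) (j : 'I_(J l)),
       #|I| = q -> (1 <= l <= m.+1)%N -> inC_time T s (lam / 2) (a I l j)) /\
    forall (t : R) (x : 'rV[R]_n), t \in `[0, T] ->
      extd (fun z => potential ker_phi q f t z
                     - potential (ker_phi_m h theta m) q f t z) x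
      = extd (fun z => \sum_(I : {set 'I_n} | #|I| == q)
                 \sum_(1 <= l < m.+2) \sum_(j < J l)
                   (a I l j t * ext_harmonic h theta j z) *: dxI I) x.
Proof.
have [_ [fC _ _ _]] := hf.
have lam2 : 0 < lam / 2 by case/andP: hlam => lam0 _; rewrite divr_gt0.
(* The form has weight [dl + 1], so the lower bound on [dl] is exactly the integrability
   condition. *)
have dln : n%:R + m%:R < dl + 1 by case/andP: hdl; rewrite ltrBlDr.
have [_ hharm _] := hh.
exists (@harmonic_moment R n q f J h); split=> [I l j _ /andP[_ lm]|t x tT].
  exact: (inC_time_harmonic_moment hT hn hUb lam2 dln fC hharm).
(* At a fixed time the two forms are equal as functions of the point, hence so are their exterior
   derivatives. *)
congr (extd _ x); apply/funext => z.
exact: (potential_sub theta hT hn hUb dln fC hharm).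
Qed.
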